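(* Let $a<1$, $p\in(0,1)$, $\gamma_0>0$ and $\boldsymbol\theta=\{\gamma_0,a,p\}$. Let the sample size $n$ have the generalized negative binomial distribution $\mathrm{gNB}(\gamma_0,a,p)$ conditioned on $n\ge2$, and given $n$ let $(z_1,\ldots,z_n)\sim\mathrm{gCRSF}(n,\gamma_0,a,p)$. Then the probability $S_{\boldsymbol\theta}$ that two distinct individuals selected uniformly at random from the sample are in two different groups (clusters) is $$S_{\boldsymbol\theta}:=P(z_1\neq z_2\mid\gamma_0,a,p)=\sum_{n=2}^\infty P(z_1\neq z_2\mid n,\gamma_0,a,p)\,\frac{\mathrm{gNB}(n;\gamma_0,a,p)}{1-\mathrm{gNB}(0;\gamma_0,a,p)-\mathrm{gNB}(1;\gamma_0,a,p)}$$ $$=\frac{\gamma_0^2p^{-2a}e^{-\gamma_0\frac{1-(1-p)^a}{ap^a}}}{1-e^{-\gamma_0\frac{1-(1-p)^a}{ap^a}}-\gamma_0p^{1-a}e^{-\gamma_0\frac{1-(1-p)^a}{ap^a}}}\sum_{n=2}^\infty\frac{p^n}{n!}R_{n,\gamma_0,a,p}(2,2).$$ When $a=0$, $$P(z_1\neq z_2\mid\gamma_0,a=0,p)=\frac{\gamma_0}{1+\gamma_0}.$$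
   Context: The generalized Chinese restaurant sampling formula $\mathrm{gCRSF}(n,\gamma_0,a,p)$ is the (exchangeable) probability distribution on partitions of $\{1,\ldots,n\}$, encoded by cluster labels $\boldsymbol z=(z_1,\ldots,z_n)$ in order of appearance (so $z_1=1$ and each new cluster gets the next unused label), given by $$p(\boldsymbol z\mid n,\gamma_0,a,p)=\frac{\gamma_0^{l}p^{-al}}{\sum_{\ell=0}^n\gamma_0^\ell p^{-a\ell}S_a(n,\ell)}\prod_{k=1}^{l}\frac{\Gamma(n_k-a)}{\Gamma(1-a)},$$ where $l$ is the number of clusters and $n_k$ the size of cluster $k$; $P(z_1\ne z_2\mid n,\gamma_0,a,p)$ is the probability of $z_1\neq z_2$ under this distribution. Here $S_a(n,l)=\frac{n!}{l!}\sum_{*}\prod_{k=1}^l\frac{\Gamma(n_k-a)}{n_k!\,\Gamma(1-a)}$ for $1\le l\le n$, with $\sum_*$ over all $l$-tuples of positive integers summing to $n$; $S_a(0,0)=1$ and $S_a(n,0)=0$ for $n\ge1$. The generalized negative binomial distribution $\mathrm{gNB}(\gamma_0,a,p)$ on $\{0,1,2,\ldots\}$ has probability mass function $$\mathrm{gNB}(n;\gamma_0,a,p)=\frac{p^n}{n!}e^{-\gamma_0\frac{1-(1-p)^a}{ap^a}}\sum_{\ell=0}^n\gamma_0^\ell p^{-a\ell}S_a(n,\ell).$$ For $a=0$, $\frac{1-(1-p)^a}{ap^a}$ is understood as its limit $-\ln(1-p)$. $R_{n,\gamma_0,a,p}(i,j)$ is defined for $1\le j\le i\le n$ by $R_{n,\gamma_0,a,p}(n,j)=1$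 and, for $i=n-1,n-2,\ldots,1$, $$R_{n,\gamma_0,a,p}(i,j)=R_{n,\gamma_0,a,p}(i+1,j)\,(i-aj)+R_{n,\gamma_0,a,p}(i+1,j+1)\,\gamma_0p^{-a}.$$ *)

(* Defs.v *)
From HB Require Import structures.
From mathcomp Require Import all_boot all_order all_algebra.
From mathcomp Require Import all_classical all_reals all_analysis.
Set Implicit Arguments.
Unset Strict Implicit.
Unset Printing Implicit Defensive.
Import Order.TTheory GRing.Theory Num.Theory numFieldNormedType.Exports.
Local Open Scope classical_set_scope.
Local Open Scope ring_scope.

(* Euler's integral; only used at x > 0, where the integral is finite. *)
Definition Gamma {R : realType} (x : R) : R :=
  fine (\int[lebesgue_measure]_(t in `]0%R, +oo[)
          (t `^ (x - 1) * expR (- t))%:E)%E.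

(* (1 - (1 - p)^a) / (a p^a), extended to a = 0 by its limit. *)
Definition gNB_rate {R : realType} (a p : R) : R :=
  if a == 0 then - ln (1 - p) else (1 - (1 - p) `^ a) / (a * p `^ a).

(* S_a(n, l).  The tuples c range over all l-tuples of positive integers with
   sum n, whose entries are necessarily at most n.  The sum is a single empty
   product at (0, 0), and is empty at (n, 0) for n >= 1. *)
Definition genStirling {R : realType} (a : R) (n l : nat) : R :=
  n`!%:R / l`!%:R *
  \sum_(c : l.-tuple 'I_n.+1 |
          [forall k, 0 < tnth c k]%N && (\sum_(k < l) tnth c k == n)%N)
    \prod_(k < l)
      (Gamma ((tnth c k : nat)%:R - a) / ((tnth c k)`!%:R * Gamma (1 - a))).

(* The sum shared by the gCRSF normalisation and the gNB mass function. *)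
Definition gen_total {R : realType} (gamma0 a p : R) (n : nat) : R :=
  \sum_(0 <= l < n.+1) gamma0 ^+ l * p `^ (- a * l%:R) * genStirling a n l.

Definition gNB {R : realType} (gamma0 a p : R) (n : nat) : R :=
  p ^+ n / n`!%:R * expR (- gamma0 * gNB_rate a p) * gen_total gamma0 a p n.

(* Labels are 1, 2, 3, ...: each entry repeats an earlier label or is the next
   unused one.  Positions in sequences start at 0, so that z_1 and z_2 are
   nth 0 z 0 and nth 0 z 1. *)
Definition appearance_order (z : seq nat) : bool :=
  all (fun i => (nth 0%N z i \in take i z)
                || (nth 0%N z i == (size (undup (take i z))).+1))
      (iota 0 (size z)).

Definition n_clusters (z : seq nat) : nat := size (undup z).

(* Mass function of gCRSF(n, gamma0, a, p) with n = size z, extended by 0 to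
   the sequences that do not encode a partition. *)
Definition gCRSF {R : realType} (gamma0 a p : R) (z : seq nat) : R :=
  if appearance_order z then
    gamma0 ^+ n_clusters z * p `^ (- a * (n_clusters z)%:R)
      / gen_total gamma0 a p (size z)
    * \prod_(1 <= k < (n_clusters z).+1)
        (Gamma ((count_mem k z)%:R - a) / Gamma (1 - a))
  else 0.

(* P(z_1 <> z_2 | n, gamma0, a, p), for n >= 2; the labels of a partition of n
   points are at most n. *)
Definition gCRSF_neq12 {R : realType} (gamma0 a p : R) (n : nat) : R :=
  \sum_(z : n.-tuple 'I_n.+1 |
          nth 0%N (map val z) 0 != nth 0%N (map val z) 1)
    gCRSF gamma0 a p (map val z).

(* Rrec gamma0 a p d i j is R_{i+d}(i, j), by recursion on d = n - i. *)
Fixpoint Rrec {R : realType} (gamma0 a p : R) (d i j : nat) : R :=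
  if d is d'.+1 then
    Rrec gamma0 a p d' i.+1 j * (i%:R - a * j%:R)
    + Rrec gamma0 a p d' i.+1 j.+1 * (gamma0 * p `^ (- a))
  else 1.

Definition Rcoef {R : realType} (gamma0 a p : R) (n i j : nat) : R :=
  Rrec gamma0 a p (n - i) i j.

Definition cond_prob {d} {T : measurableType d} {R : realType}
    (P : probability T R) (A B : set T) : R :=
  fine (P (A `&` B)) / fine (P B).

(* N ~ gNB; given N = n >= 2, (Z 0, ..., Z (n-1)) ~ gCRSF(n); given these,
   (I, J) is a uniformly random ordered pair of distinct positions among
   0, ..., n-1.  The variables Z k with k >= N are irrelevant. *)
Definition gCRSF_sampling {d} {T : measurableType d} {R : realType}
    (P : probability T R) (gamma0 a p : R)
    (N : {RV P >-> nat}) (Z : nat -> {RV P >-> nat}) (I J : {RV P >-> nat})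
    : Prop :=
  [/\ forall n : nat, P [set w | N w = n] = (gNB gamma0 a p n)%:E,
      forall (n : nat) (z : n.-tuple nat), (2 <= n)%N ->
        P [set w | N w = n /\ forall k : 'I_n, Z k w = tnth z k]
        = (P [set w | N w = n] * (gCRSF gamma0 a p z)%:E)%E
    & forall (n : nat) (z : n.-tuple nat) (i j : nat), (2 <= n)%N ->
        P [set w | [/\ N w = n, forall k : 'I_n, Z k w = tnth z k,
                       I w = i & J w = j]]
        = (P [set w | N w = n /\ forall k : 'I_n, Z k w = tnth z k]
           * (if [&& (i < n)%N, (j < n)%N & i != j]
              then ((n * n.-1)%:R)^-1 else 0)%:E)%E].

(* Main.v *)
Require Import Defs.
From HB Require Import structures.
From mathcomp Require Import all_boot all_order all_algebra fingroup perm.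
From mathcomp Require Import all_classical all_reals all_analysis.
From mathcomp Require Import measurable_realfun ring lra zify.
Import Order.TTheory GRing.Theory Num.Theory numFieldNormedType.Exports.
Local Open Scope classical_set_scope.
Local Open Scope ring_scope.

(* Put x = gamma0 p^(-a) and W(z) = x^l prod_k (1-a)(2-a)...(n_k-1-a); by the
   functional equation of Gamma, gCRSF(z) = W(z) / T_n, where T_n is the factor
   of the gNB mass function, which thus cancels in P(z_1 <> z_2 | n) gNB(n).
   Joining the i-th point to a cluster of size m multiplies W by m - a, opening
   a new cluster multiplies it by x; summing over all ways to append points to
   z = (1, 2) gives sum_{z_1 <> z_2} W(z) = x^2 R_n(2, 2).

   W depends only on the block sizes, so permuting the positions and relabelling
   by order of appearance preserves it; hence every pair of distinct positions
   has the same probability of being separated.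

   The sum over n converges because the exponential generating function of
   d |-> R_{i+d}(i, j) satisfies a system of differential inequalities.  At a = 0
   the coefficients are rising factorials, and the negative binomial series
   gives the closed form. *)

(** * The functional equation of Gamma *)

(** For x >= 1 the power x^y is at most x^m, and the exponential series gives e^x >= x^(m+1) /
    (m+1)!. *)
Lemma powR_expRN_le (R : realType) (y x : R) (m : nat) : y <= m%:R -> 1 <= x ->
  x `^ y * expR (- x) <= m.+1`!%:R / x.
Proof.
move=> ym x1; have x0 : 0 < x by apply: lt_le_trans x1.
rewrite expRN ler_pdivrMr ?expR_gt0// mulrAC ler_pdivlMr//.
apply: (@le_trans _ _ (x ^+ m * x)).
  by rewrite ler_pM2r// -powR_mulrn ?ler_powR// ltW.
rewrite -exprSr -ler_pdivrMl ?ltr0n ?fact_gt0// mulrC.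
by apply: le_trans (expR_ge1Dxn m (ltW x0)); rewrite lerDr.
Qed.

Lemma cvg_powR_expRN (R : realType) (y : R) :
  (n.+2%:R : R) `^ y * expR (- n.+2%:R) @[n --> \oo] --> 0.
Proof.
have [m ym] : exists m : nat, y <= m%:R.
  by exists (Num.bound y); exact: ltW (unstable.ltr_bound y).
apply: (@squeeze_cvgr _ _ _ _ (fun=> 0) (fun n => m.+1`!%:R * n.+2%:R^-1)).
- near=> n; rewrite mulr_ge0 ?powR_ge0 ?expR_ge0//=.
  by apply: powR_expRN_le => //; rewrite ler1n.
- exact: cvg_cst.
- suff : m.+1`!%:R * (n.+2%:R : R)^-1 @[n --> \oo] --> (m.+1`!%:R * 0 : R).
    by rewrite mulr0.
  apply: cvgM; first exact: cvg_cst.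
  by have := @cvg_harmonic R; rewrite -cvg_shiftS.
Unshelve. all: by end_near.
Qed.

Lemma cvg_powR_inv_expRN (R : realType) (y : R) : 0 < y ->
  ((n.+2%:R : R)^-1) `^ y * expR (- n.+2%:R^-1) @[n --> \oo] --> 0.
Proof.
move=> y0.
have h : (n.+2%:R : R)^-1 @[n --> \oo] --> (0 : R).
  by have := @cvg_harmonic R; rewrite -cvg_shiftS.
apply: (@squeeze_cvgr _ _ _ _ (fun=> 0) (fun n => (n.+2%:R)^-1 `^ y)).
- near=> n; rewrite mulr_ge0 ?powR_ge0 ?expR_ge0//=.
  by rewrite ler_piMr ?powR_ge0// expR_le1 oppr_le0 invr_ge0.
- exact: cvg_cst.
- have /cvg_at_rightP := powR_cvg0 y0; apply; split => // n.
Unshelve. all: by end_near.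
Qed.

(** Euler's integral kept as an extended real: the functional equation is proved before finiteness
    is known, and finiteness is then deduced from it. *)
Definition Gamma_integral {R : realType} (x : R) : \bar R :=
  (\int[lebesgue_measure]_(t in `]0%R, +oo[)
     (t `^ (x - 1) * expR (- t))%:E)%E.

Lemma measurable_Gamma_integrand (R : realType) (D : set R) (y : R) :
  measurable_fun D (EFin \o (fun t : R => t `^ y * expR (- t))).
Proof.
apply: measurable_funTS; apply/measurable_EFinP; apply: measurable_funM.
  exact: measurable_powR.
by apply: measurableT_comp => //; apply: measurableT_comp.
Qed.

Lemma continuous_powR (R : realType) (y x : R) : 0 < x ->
  {for x, continuous (fun t => t `^ y)}.
Proof.
move=> x0; apply: differentiable_continuous; apply/derivable1_diffP.
by apply: derivable_powR; rewrite in_itv/= x0.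
Qed.

Lemma continuous_expRN (R : realType) : continuous (fun t : R => expR (- t)).
Proof.
move=> x; apply: continuous_comp; last exact: continuous_expR.
exact: opp_continuous.
Qed.

Lemma Gamma_integral_by_parts (R : realType) (y b c : R) :
  0 <= y -> 0 < b -> b < c ->
  (\int[lebesgue_measure]_(t in `[b, c]) (t `^ y * expR (- t))%:E =
   (b `^ y * expR (- b) - c `^ y * expR (- c))%:E +
   y%:E * \int[lebesgue_measure]_(t in `[b, c]) (t `^ (y - 1) * expR (- t))%:E)%E.
Proof.
move=> y0 b0 bc.
have pos t : t \in `[b, c] -> 0 < t.
  by rewrite in_itv/= => /andP[bt _]; exact: lt_le_trans bt.
have within (f : R -> R) : (forall t, 0 < t -> {for t, continuous f}) ->
    {within `[b, c], continuous f}.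
  move=> cf; apply: continuous_in_subspaceT => t.
  by rewrite inE => /pos /cf.
have cG : continuous (fun t : R => - expR (- t)).
  by move=> t; apply: cvgN; exact: continuous_expRN.
rewrite (@integration_by_parts _ (fun t => t `^ y) (fun t => - expR (- t))
  (fun t => y * t `^ (y - 1)) (fun t => expR (- t)))//; first last.
- move=> t _; rewrite derive1_comp// derive1N// derive1_id mulN1r derive1_comp//.
  rewrite derive1N// derive1_id derive1E.
  by have /funeqP -> := @derive_expR R; rewrite mulrN1 opprK.
- split.
  + by move=> z _; exact: ex_derive.
  + by apply/cvg_at_right_filter; exact: cG.
  + by apply/cvg_at_left_filter; exact: cG.
- by apply: within => t _; exact: continuous_expRN.
- move=> t tbc; rewrite powR_derive1// in_itv/= andbT.
  by apply: pos; exact: subset_itv_oo_cc.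
- split.
  + move=> t tbc; apply: derivable_powR; rewrite in_itv/= andbT.
    by apply: pos; exact: subset_itv_oo_cc.
  + by apply/cvg_at_right_filter; exact: continuous_powR.
  + by apply/cvg_at_left_filter; apply: continuous_powR; exact: lt_trans bc.
- apply: within => t t0.
  by apply: cvgM; [exact: cvg_cst|exact: continuous_powR].
have I0 t : (0 <= (t `^ (y - 1) * expR (- t))%:E)%E.
  by rewrite lee_fin mulr_ge0 ?powR_ge0 ?expR_ge0.
under [X in (_ - X)%E = _]eq_integral do rewrite mulrN -mulrA EFinN EFinM.
rewrite integral_ge0N//=; last by move=> t _; rewrite mule_ge0.
rewrite oppeK ge0_integralZl//=; last exact: measurable_Gamma_integrand.
by congr (_%:E + _)%E; ring.
Qed.

Lemma Gamma_integral_ge0 (R : realType) (x : R) : (0 <= Gamma_integral x)%E.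
Proof.
by apply: integral_ge0 => t _; rewrite lee_fin mulr_ge0 ?powR_ge0 ?expR_ge0.
Qed.

Lemma bigcup_itv_inv (R : realType) :
  \bigcup_n `[(n.+2%:R : R)^-1, n.+2%:R]%classic = `]0, +oo[%classic.
Proof.
apply/seteqP; split=> [t [n _]|t] /=; rewrite !in_itv/=.
  by move=> /andP[nt _]; rewrite andbT (lt_le_trans _ nt).
rewrite andbT => t0.
have h1 := unstable.ltr_bound t; have h2 := unstable.ltr_bound t^-1.
exists (Num.bound t + Num.bound t^-1)%N => //=; rewrite in_itv/=.
apply/andP; split.
  rewrite -[leRHS]invrK lef_pV2 ?posrE ?invr_gt0//.
  by apply: (le_trans (ltW h2)); rewrite ler_nat; do 2 apply: leqW; exact: leq_addl.
by apply: (le_trans (ltW h1)); rewrite ler_nat; do 2 apply: leqW; exact: leq_addr.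
Qed.

(** Monotone convergence over the growing segments [1/(n+2), n+2]; starting at 2 makes each of them
    nondegenerate, as integration by parts requires. *)
Lemma cvg_Gamma_integral (R : realType) (y : R) :
  (\int[lebesgue_measure]_(t in `[(n.+2%:R^-1)%R, (n.+2%:R)%R])
     (t `^ (y - 1) * expR (- t))%:E)%E @[n --> \oo] --> Gamma_integral y.
Proof.
rewrite /Gamma_integral -bigcup_itv_inv.
apply: (@ge0_nondecreasing_set_cvg_integral _ (measurableTypeR R) R
  (fun n => `[(n.+2%:R : R)^-1, n.+2%:R]%classic)
  (fun t => (t `^ (y - 1) * expR (- t))%:E) lebesgue_measure).
- move=> m n mn; rewrite subsetEset; apply: subset_itv; rewrite bnd_simp.
    by rewrite lef_pV2 ?posrE// ler_nat; lia.
  by rewrite ler_nat; lia.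
- by move=> n; exact: measurable_itv.
- by move=> n; exact: measurable_Gamma_integrand.
- by move=> n t _; rewrite lee_fin mulr_ge0 ?powR_ge0 ?expR_ge0.
Qed.

(** Integration by parts on these segments; the boundary terms at both ends tend to 0. *)
Lemma Gamma_integralS (R : realType) (y : R) : 0 < y ->
  Gamma_integral (y + 1) = (y%:E * Gamma_integral y)%E.
Proof.
move=> y0; have h := @cvg_Gamma_integral R (y + 1); rewrite addrK in h.
apply: cvg_unique h _ => //.
rewrite (_ : (fun n => _) = (fun n =>
  ((n.+2%:R^-1) `^ y * expR (- n.+2%:R^-1) - n.+2%:R `^ y * expR (- n.+2%:R))%:E
  + y%:E * \int[lebesgue_measure]_(t in `[(n.+2%:R^-1)%R, (n.+2%:R)%R])
       (t `^ (y - 1) * expR (- t))%:E)%E); last first.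
  apply/funext => n; rewrite Gamma_integral_by_parts ?ltW//.
  by rewrite (@le_lt_trans _ _ 1) ?invf_le1 ?ler1n ?ltr1n.
rewrite -[(_ * Gamma_integral y)%E]add0e; apply: cvgeD => //.
  apply: cvg_EFin; first by near=> n.
  have h0 := cvgB (cvg_powR_inv_expRN _ _ y0) (@cvg_powR_expRN R y).
  by rewrite subr0 in h0; exact: h0.
apply: cvgeZl => //; exact: cvg_Gamma_integral.
Unshelve. all: by end_near.
Qed.

Lemma Gamma_integral1 (R : realType) : Gamma_integral (1 : R) = 1%E.
Proof.
rewrite /Gamma_integral integral_itv_obnd_cbnd; last first.
  exact: measurable_Gamma_integrand.
rewrite -(@integral_exponential_pdf R 1)// /exponential_pdf.
rewrite [LHS]integral_mkcond; apply: eq_integral => t _; rewrite !patchE.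
by case: ifP => //= _; rewrite subrr powRr0 mulN1r.
Qed.

(** Positive integers follow by induction from the functional equation. For general x it suffices to
    bound the integral at x + 1, where the exponent x is positive: t^x is at most 1 for t <= 1 and
    at most t^m for t > 1. *)
Lemma Gamma_integral_lty (R : realType) (x : R) : 0 < x ->
  (Gamma_integral x < +oo)%E.
Proof.
move=> x0.
have natty n : (Gamma_integral (n.+1%:R : R) < +oo)%E.
  elim: n => [|n IH]; first by rewrite Gamma_integral1 ltry.
  rewrite -natr1 Gamma_integralS//.
  by rewrite lte_mul_pinfty// lee_fin.
suff: (Gamma_integral (x + 1) < +oo)%E.
  rewrite Gamma_integralS//.
  case: (Gamma_integral x) (Gamma_integral_ge0 R x) => [r _ _|_|//].
    exact: ltry.
  by rewrite gt0_muley ?lte_fin.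
have [m xm] : exists m : nat, x <= m%:R.
  by exists (Num.bound x); exact: ltW (unstable.ltr_bound x).
apply: (@le_lt_trans _ _ (Gamma_integral 1 + Gamma_integral (m.+1%:R))); last first.
  by rewrite Gamma_integral1 lte_add_pinfty ?ltry.
have I0 (y t : R) : (0 <= (t `^ y * expR (- t))%:E)%E.
  by rewrite lee_fin mulr_ge0 ?powR_ge0 ?expR_ge0.
rewrite /Gamma_integral -ge0_integralD//=; last 2 first.
- exact: measurable_Gamma_integrand.
- exact: measurable_Gamma_integrand.
apply: ge0_le_integral => //=.
- exact: measurable_Gamma_integrand.
- by apply: emeasurable_funD; exact: measurable_Gamma_integrand.
move=> t; rewrite /= in_itv/= andbT => t0.
rewrite -EFinD lee_fin -mulrDl ler_pM2r ?expR_gt0// subrr powRr0 !addrK.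
have [t1|t1] := leP t 1.
  rewrite -[leLHS]addr0 lerD ?powR_ge0//.
  by rewrite -(powRr0 t) ger_powR ?t0 ?(ltW x0).
rewrite -[leLHS]add0r lerD// ler_powR ?(ltW t1)//.
by rewrite -natr1 addrK.
Qed.

Lemma Gamma_integral_gt0 (R : realType) (x : R) : (0 < Gamma_integral x)%E.
Proof.
(* A lower bound for the integrand on [1, 2], where 0 <= ln t <= 1 and t <= 2. *)
pose k := expR (- `|x - 1| - 2).
have k0 : 0 < k by exact: expR_gt0.
apply: (@lt_le_trans _ _ (\int[lebesgue_measure]_(t in `[1%R, 2%R]) (k%:E))%E).
  rewrite integral_cst//= lebesgue_measure_itv/= lte_fin ltr1n/=.
  by rewrite -EFinB -EFinM lte_fin mulr_gt0// subr_gt0 ltr1n.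
apply: (@le_trans _ _ (\int[lebesgue_measure]_(t in `[1%R, 2%R])
          (t `^ (x - 1) * expR (- t))%:E)%E).
  apply: ge0_le_integral => //=.
  - by move=> t _; rewrite lee_fin ltW.
  - exact: measurable_Gamma_integrand.
  move=> t; rewrite /= in_itv/= => /andP[t1 t2].
  have t0 : 0 < t by apply: lt_le_trans t1.
  rewrite lee_fin /k /powR gt_eqF// -expRD ler_expR.
  have l0 := ln_ge0 t1.
  have l1 : ln t <= 1.
    by have := @le_ln1Dx R (t - 1); rewrite addrCA subrr addr0; lra.
  rewrite lerD ?lerN2// lerNl -mulNr.
  apply: (le_trans (ler_norm _)); rewrite normrM normrN ger0_norm//.
  by rewrite ler_piMr.
apply: ge0_subset_integral => //=.
- exact: measurable_Gamma_integrand.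
- by move=> t _; rewrite lee_fin mulr_ge0 ?powR_ge0 ?expR_ge0.
- by move=> t /=; rewrite !in_itv/= andbT => /andP[t1 _]; exact: lt_le_trans t1.
Qed.

Lemma GammaE (R : realType) (x : R) : 0 < x ->
  (Gamma x)%:E = Gamma_integral x.
Proof.
by move=> x0; rewrite fineK// ge0_fin_numE ?Gamma_integral_ge0// Gamma_integral_lty.
Qed.

Lemma Gamma_gt0 (R : realType) (x : R) : 0 < x -> 0 < Gamma x.
Proof. by move=> x0; rewrite -lte_fin GammaE// Gamma_integral_gt0. Qed.

Lemma GammaS (R : realType) (x : R) : 0 < x -> Gamma (x + 1) = x * Gamma x.
Proof.
move=> x0; apply: EFin_inj; rewrite EFinM !GammaE ?addr_gt0//.
exact: Gamma_integralS.
Qed.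

Lemma Gamma_ratio (R : realType) (a : R) (m : nat) : a < 1 ->
  Gamma (m.+1%:R - a) / Gamma (1 - a) = \prod_(i < m) (i.+1%:R - a).
Proof.
move=> a1; have G0 : Gamma (1 - a) != 0 by rewrite gt_eqF// Gamma_gt0// subr_gt0.
elim: m => [|m IH]; first by rewrite big_ord0 divff.
rewrite big_ord_recr/= -IH -natr1 addrAC GammaS; first by field.
by rewrite subr_gt0 (lt_le_trans a1)// ler1n.
Qed.

(** * Weights of label sequences *)

(** For m >= 1 this is Gamma(m - a) / Gamma(1 - a), with Gamma eliminated. *)
Definition block_weight {R : realType} (a : R) (m : nat) : R :=
  \prod_(i < m.-1) (i.+1%:R - a).

(** The unnormalised gCRSF mass. Ranging over the labels that occur, rather than over 1, ..., l,
    makes it meaningful before relabelling by order of appearance. *)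
Definition weight {R : realType} (x a : R) (z : seq nat) : R :=
  \prod_(k <- undup z) (x * block_weight a (count_mem k z)).

Lemma appearance_order_rcons (s : seq nat) (y : nat) :
  appearance_order (rcons s y) =
  appearance_order s && ((y \in s) || (y == (size (undup s)).+1)).
Proof.
rewrite /appearance_order size_rcons -addn1 iotaD all_cat/= andbT add0n.
rewrite nth_rcons ltnn eqxx -cats1 take_size_cat//; congr (_ && _).
apply: eq_in_all => i; rewrite mem_iota/= add0n => ilt.
by rewrite takel_cat ?(ltnW ilt)// nth_cat ilt.
Qed.

Lemma appearance_order_cat (s t : seq nat) :
  appearance_order (s ++ t) -> appearance_order s.
Proof.
elim/last_ind: t => [|t y IH]; first by rewrite cats0.
by rewrite -rcons_cat appearance_order_rcons => /andP[/IH].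
Qed.

(** Only up to permutation: [undup] keeps last occurrences, so a repeated label moves to the end. *)
Lemma perm_undup_rcons (T : eqType) (s : seq T) (y : T) :
  perm_eq (undup (rcons s y)) (if y \in s then undup s else y :: undup s).
Proof.
apply: uniq_perm; rewrite ?undup_uniq//.
  by case: ifPn => ys; rewrite /= ?undup_uniq// mem_undup ys.
move=> k; rewrite mem_undup mem_rcons in_cons.
case: ifPn => ys; rewrite ?in_cons mem_undup//.
by case: eqVneq => [->|].
Qed.

Lemma mem_appearance_order (s : seq nat) : appearance_order s ->
  s =i iota 1 (size (undup s)).
Proof.
elim/last_ind: s => [//|s y IH]; rewrite appearance_order_rcons => /andP[/IH{}IH].
have /perm_size -> := perm_undup_rcons _ s y.
move=> h k; rewrite mem_rcons in_cons IH; move: h; rewrite IH !mem_iota.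
by case: ifPn => /=; move: (size _) k => n k; lia.
Qed.

Lemma perm_undup_iota (s : seq nat) : appearance_order s ->
  perm_eq (undup s) (iota 1 (size (undup s))).
Proof.
move=> sA; apply: uniq_perm; rewrite ?undup_uniq ?iota_uniq// => k.
by rewrite mem_undup mem_appearance_order.
Qed.

Lemma sum_count_undup (T : eqType) (s : seq T) :
  (\sum_(k <- undup s) count_mem k s)%N = size s.
Proof.
rewrite -[in RHS](perm_size (perm_count_undup s)) size_flatten /shape -map_comp.
rewrite sumnE big_map; apply: eq_bigr => k _.
by rewrite /= size_nseq.
Qed.

Lemma block_weightS (R : realType) (a : R) (m : nat) : (0 < m)%N ->
  block_weight a m.+1 = block_weight a m * (m%:R - a).
Proof. by case: m => // m _; rewrite /block_weight /= big_ord_recr. Qed.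

Lemma weight_rcons_new (R : realType) (x a : R) (s : seq nat) (y : nat) :
  y \notin s -> weight x a (rcons s y) = weight x a s * x.
Proof.
move=> ys; rewrite /weight (perm_big _ (perm_undup_rcons _ s y)) (negbTE ys).
rewrite big_cons [RHS]mulrC; congr (_ * _).
  rewrite -cats1 count_cat (count_memPn ys)/= eqxx.
  by rewrite /block_weight big_ord0 mulr1.
apply: eq_big_seq => k; rewrite mem_undup => ks.
rewrite -cats1 count_cat /= addn0; case: eqVneq ks ys => [<- ->//|_ _ _].
by rewrite addn0.
Qed.

Lemma weight_rcons_old (R : realType) (x a : R) (s : seq nat) (y : nat) :
  y \in s ->
  weight x a (rcons s y) = weight x a s * ((count_mem y s)%:R - a).
Proof.
move=> ys; rewrite /weight (perm_big _ (perm_undup_rcons _ s y)) ys.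
have yu : y \in undup s by rewrite mem_undup.
rewrite (bigD1_seq y)//= ?undup_uniq// [in RHS](bigD1_seq y)//= ?undup_uniq//.
rewrite [in RHS]mulrAC; congr (_ * _).
  rewrite -cats1 count_cat /= eqxx !addn1 block_weightS ?mulrA//.
  by rewrite -has_count has_pred1.
apply: eq_bigr => k ky; rewrite -cats1 count_cat /= addn0.
by rewrite eq_sym (negbTE ky) addn0.
Qed.

(** The admissible next labels are the l labels in use and l + 1, all below [m] by the size bound.
    The factors n_k - a of the old labels add up to [size s] - a l, the new label contributes x. The
    function [F] leaves room for the remaining points. *)
Lemma sum_weight_rcons (R : realType) (x a : R) (m : nat) (s : seq nat)
    (F : nat -> R) :
  appearance_order s -> (size s + 1 < m)%N ->
  \sum_(y < m | appearance_order (rcons s y))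
     weight x a (rcons s y) * F (size (undup (rcons s y))) =
  weight x a s * (F (size (undup s)) * ((size s)%:R - a * (size (undup s))%:R)
                  + F (size (undup s)).+1 * x).
Proof.
move=> sA sm; set l := size (undup s).
have ls : (l <= size s)%N by exact: size_undup.
have memE y : (y \in s) = (0 < y < l.+1)%N.
  by rewrite mem_appearance_order// mem_iota add1n.
transitivity (\sum_(y <- l.+1 :: undup s)
     weight x a (rcons s y) * F (size (undup (rcons s y)))).
  rewrite -(big_mkord (fun y => appearance_order (rcons s y))
    (fun y => weight x a (rcons s y) * F (size (undup (rcons s y))))).
  rewrite -big_filter; apply: perm_big; apply: uniq_perm.
  - by rewrite filter_uniq// iota_uniq.
  - by rewrite /= undup_uniq mem_undup memE ltnn andbF.
  move=> y; rewrite mem_filter mem_index_iota appearance_order_rcons sA.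
  rewrite in_cons mem_undup memE /= -/l.
  by apply/idP/idP; lia.
have lnew : l.+1 \notin s by rewrite memE ltnn andbF.
rewrite big_cons weight_rcons_new// (perm_size (perm_undup_rcons _ s l.+1)).
rewrite (negbTE lnew)/= -/l mulrDr addrC; congr (_ + _); last by ring.
under eq_big_seq => y.
  rewrite mem_undup => ys.
  rewrite weight_rcons_old// (perm_size (perm_undup_rcons _ s y)) ys -/l.
  rewrite -mulrA (mulrC _ (F l)).
  over.
rewrite -!mulr_sumr sumrB -natr_sum sum_count_undup big_const_seq count_predT.
by rewrite iter_addr_0 -/l mulr_natr.
Qed.

Lemma big_tupleS (R : nmodType) (T : finType) (d : nat) (P : pred (seq T))
    (F : seq T -> R) :
  \sum_(t : d.+1.-tuple T | P t) F t =
  \sum_(y : T) \sum_(t : d.-tuple T | P (y :: t)) F (y :: t).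
Proof.
rewrite pair_big_dep /=.
rewrite (reindex (fun u : T * d.-tuple T => [tuple of u.1 :: u.2]))//.
exists (fun t => (thead t, [tuple of behead t])) => [[y t] _|t _] /=.
  by congr pair; apply: val_inj.
by rewrite [RHS](tuple_eta t); apply: val_inj.
Qed.

(** Induction on the number [d] of points still to be appended: with [F] the value of [Rrec] one
    point later, [sum_weight_rcons] is exactly the recursion of [Rrec]. *)
Lemma sum_weight_ext (R : realType) (gamma0 a p : R) (m d : nat) (s : seq nat) :
  appearance_order s -> (size s + d < m)%N ->
  \sum_(t : d.-tuple 'I_m | appearance_order (s ++ map val t))
     weight (gamma0 * p `^ (- a)) a (s ++ map val t) =
  weight (gamma0 * p `^ (- a)) a s
    * Rrec gamma0 a p d (size s) (size (undup s)).
Proof.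
elim: d s => [|d IH] s sA sm.
  rewrite (big_pred1 [tuple]) ?cats0 ?mulr1// => t.
  by rewrite tuple0 cats0 sA; apply/esym/eqP.
rewrite (big_tupleS _ _ _ (fun t => appearance_order (s ++ map val t))
  (fun t => weight (gamma0 * p `^ (- a)) a (s ++ map val t))).
(* A first label that already breaks the order of appearance admits no valid continuation, so its
   part of the sum vanishes. *)
rewrite (bigID (fun y : 'I_m => appearance_order (rcons s y)))/=.
rewrite [X in _ + X]big1 ?addr0; last first.
  move=> y yA; rewrite big1// => t; rewrite -cat_rcons.
  by move=> /appearance_order_cat; rewrite (negbTE yA).
rewrite -(sum_weight_rcons _ _ _ m s (fun l => Rrec gamma0 a p d (size s).+1 l))//.
  apply: eq_bigr => y yA; under eq_bigl do rewrite -cat_rcons.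
  under eq_bigr do rewrite -cat_rcons.
  by rewrite IH// size_rcons// addSnnS.
lia.
Qed.

(** * Relabelling by order of appearance and exchangeability *)

(** The rank of [y], counted from 1, in the order of first appearance in [s]. *)
Definition label (s : seq nat) (y : nat) : nat :=
  (size (undup (take (index y s) s))).+1.

Definition relabel (s : seq nat) : seq nat := map (label s) s.

Lemma undup_map_in (T1 T2 : eqType) (f : T1 -> T2) (s : seq T1) :
  {in s &, injective f} -> undup (map f s) = map f (undup s).
Proof.
elim: s => //= y s IH fI.
have {}IH : undup (map f s) = map f (undup s).
  by apply: IH => u v us vs; apply: fI; rewrite in_cons ?us ?vs orbT.
suff -> : (f y \in map f s) = (y \in s) by case: ifP; rewrite /= IH.
apply/mapP/idP => [[v vs yv]|ys]; last by exists y.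
by rewrite (fI _ _ _ _ yv)// in_cons ?eqxx ?vs ?orbT.
Qed.

Lemma count_mem_map_in (T1 T2 : eqType) (f : T1 -> T2) (s : seq T1) (y : T1) :
  {in s &, injective f} -> y \in s ->
  count_mem (f y) (map f s) = count_mem y s.
Proof.
move=> fI ys; rewrite count_map; apply: eq_in_count => k ks /=.
by apply/eqP/eqP => [/fI ->|->].
Qed.

Lemma index_map_in (T1 T2 : eqType) (f : T1 -> T2) (s : seq T1) (y : T1) :
  {in s &, injective f} -> y \in s -> index (f y) (map f s) = index y s.
Proof.
elim: s => //= k s IH fI; rewrite in_cons => yks.
have -> : (f k == f y) = (k == y).
  by apply/eqP/eqP => [/fI ->|->]//; rewrite in_cons ?eqxx.
case: eqVneq => // ky; rewrite eq_sym (negbTE ky)/= in yks.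
by rewrite IH// => u v us vs; apply: fI; rewrite in_cons ?us ?vs orbT.
Qed.

Lemma weight_map_in (R : realType) (x a : R) (f : nat -> nat) (s : seq nat) :
  {in s &, injective f} -> weight x a (map f s) = weight x a s.
Proof.
move=> fI; rewrite /weight undup_map_in// big_map.
by apply: eq_big_seq => k; rewrite mem_undup => ks; rewrite count_mem_map_in.
Qed.

(** If [y] first appears before [v], the prefix before [v] contains [y] besides all that precedes
    [y], so the number of distinct entries strictly grows. *)
Lemma label_inj (s : seq nat) : {in s &, injective (label s)}.
Proof.
suff lt y v : y \in s -> v \in s -> (index y s < index v s)%N ->
    (size (undup (take (index y s) s)) < size (undup (take (index v s) s)))%N.
  move=> y v ys vs [] szE; case: (ltngtP (index y s) (index v s)).
  - by move=> /(lt _ _ ys vs); rewrite szE ltnn.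
  - by move=> /(lt _ _ vs ys); rewrite szE ltnn.
  by move=> yv; rewrite -(nth_index 0%N ys) yv nth_index.
move=> ys vs yv.
have sub : {subset y :: undup (take (index y s) s)
            <= undup (take (index v s) s)}.
  move=> k; rewrite in_cons !mem_undup => /orP[/eqP ->|kt].
    by rewrite in_take.
  have ks := mem_take kt; move: kt; rewrite !in_take// => /ltn_trans; exact.
apply: (uniq_leq_size _ sub).
by rewrite /= undup_uniq mem_undup in_take// ltnn.
Qed.

Lemma appearance_orderP (s : seq nat) :
  reflect (forall i, (i < size s)%N -> nth 0%N s i \notin take i s ->
             nth 0%N s i = (size (undup (take i s))).+1)
          (appearance_order s).
Proof.
apply: (iffP allP) => [sA i ils nin|h i].
  have := sA i; rewrite mem_iota add0n => /(_ ils).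
  by rewrite (negbTE nin) => /eqP.
rewrite mem_iota add0n => /= ils; case: (boolP (_ \in take i s)) => //= nin.
by rewrite (h i).
Qed.

(** At a first occurrence the label counts the distinct entries of the prefix, and relabelling,
    being injective, does not change that count. *)
Lemma appearance_order_relabel (s : seq nat) : appearance_order (relabel s).
Proof.
apply/appearance_orderP => i; rewrite size_map => ils.
rewrite (nth_map 0%N)// -map_take => nin.
have {}nin : nth 0%N s i \notin take i s.
  by apply: contra nin => nin; apply: map_f.
have idx : index (nth 0%N s i) s = i.
  apply/eqP; rewrite eqn_leq index_nth//= leqNgt -in_take//; exact: mem_nth.
rewrite /label idx undup_map_in ?size_map// => u v /mem_take us /mem_take vs.
exact: label_inj.
Qed.

Lemma relabel_id (s : seq nat) : appearance_order s -> relabel s = s.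
Proof.
move=> /appearance_orderP sA; rewrite -[RHS]map_id; apply/eq_in_map => y ys.
rewrite /label -{2}(nth_index 0%N ys) sA ?index_mem ?nth_index//.
by rewrite in_take// ltnn.
Qed.

(** The result depends only on the partition that the sequence induces, not on the names of its
    labels. *)
Lemma relabel_map_in (f : nat -> nat) (s : seq nat) :
  {in s &, injective f} -> relabel (map f s) = relabel s.
Proof.
move=> fI; rewrite /relabel -map_comp; apply/eq_in_map => y ys /=.
rewrite /label index_map_in// -map_take undup_map_in ?size_map//.
by move=> u v /mem_take us /mem_take vs; apply: fI.
Qed.

Lemma weight_relabel (R : realType) (x a : R) (s : seq nat) :
  weight x a (relabel s) = weight x a s.
Proof. by rewrite weight_map_in//; exact: label_inj. Qed.

(** The action of a permutation on set partitions, carried over to label sequences. Labels after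
    relabelling are at most [n], so [inord] never falls back to its default. *)
Definition relabel_perm (n : nat) (g : 'S_n) (z : n.-tuple 'I_n.+1) :
    n.-tuple 'I_n.+1 :=
  [tuple inord (nth 0%N (relabel [seq val (tnth z (g i)) | i <- enum 'I_n]) k)
  | k < n].

Lemma val_relabel_perm (n : nat) (g : 'S_n) (z : n.-tuple 'I_n.+1) :
  map val (relabel_perm n g z) =
  relabel [seq val (tnth z (g i)) | i <- enum 'I_n].
Proof.
set s := [seq val (tnth z (g i)) | i <- enum 'I_n].
have ss : size s = n by rewrite size_map size_enum_ord.
apply: (@eq_from_nth _ 0%N); first by rewrite size_map size_tuple size_map ss.
move=> i; rewrite size_map size_tuple => iltn.
rewrite (nth_map ord0) ?size_tuple//.
rewrite -[i in LHS]/(val (Ordinal iltn)) -tnth_nth tnth_mktuple /= inordK//.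
rewrite (nth_map 0%N) ?ss// /label !ltnS -[X in (_ < X)%N]ss.
apply: leq_ltn_trans (size_undup _) _; rewrite size_take.
have h : (index (nth 0%N s i) s < size s)%N by rewrite index_mem mem_nth ?ss.
by rewrite ifT.
Qed.

Lemma tnth_relabel_perm (n : nat) (g : 'S_n) (z : n.-tuple 'I_n.+1) (k : 'I_n) :
  val (tnth (relabel_perm n g z) k) =
  label [seq val (tnth z (g i)) | i <- enum 'I_n] (val (tnth z (g k))).
Proof.
transitivity (nth 0%N (map val (relabel_perm n g z)) k).
  by rewrite (nth_map ord0) ?size_tuple// -tnth_nth.
rewrite val_relabel_perm (nth_map 0%N).
  by rewrite (nth_map k) ?size_enum_ord// nth_ord_enum.
by rewrite size_map size_enum_ord.
Qed.

Lemma eq_tnth_relabel_perm (n : nat) (g : 'S_n) (z : n.-tuple 'I_n.+1)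
    (i j : 'I_n) :
  (tnth (relabel_perm n g z) i == tnth (relabel_perm n g z) j) =
  (tnth z (g i) == tnth z (g j)).
Proof.
have mem k : val (tnth z (g k)) \in [seq val (tnth z (g i)) | i <- enum 'I_n].
  by apply: (map_f (fun i => val (tnth z (g i)))); rewrite mem_enum.
rewrite -!val_eqE !tnth_relabel_perm; apply/eqP/eqP => [|->//].
exact: label_inj.
Qed.

Lemma map_val_tnth (n m : nat) (z : n.-tuple 'I_m) :
  [seq val (tnth z i) | i <- enum 'I_n] = map val z.
Proof. by rewrite (map_comp val (tnth z)) map_tnth_enum. Qed.

Lemma perm_map_val_tnth (n m : nat) (g : 'S_n) (z : n.-tuple 'I_m) :
  perm_eq [seq val (tnth z (g i)) | i <- enum 'I_n] (map val z).
Proof.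
rewrite -map_val_tnth (map_comp (fun i => val (tnth z i)) g).
apply: perm_map; apply: uniq_perm; [| |move=> i].
- by rewrite map_inj_uniq; [exact: enum_uniq|exact: perm_inj].
- exact: enum_uniq.
rewrite mem_enum; apply/mapP; exists ((g^-1)%g i).
  by rewrite mem_enum.
by rewrite permKV.
Qed.

Lemma weight_perm (R : realType) (x a : R) (s t : seq nat) :
  perm_eq s t -> weight x a s = weight x a t.
Proof.
move=> st; rewrite /weight; have ust : perm_eq (undup s) (undup t).
  apply: uniq_perm; rewrite ?undup_uniq// => k.
  by rewrite !mem_undup (perm_mem st).
rewrite (perm_big _ ust); apply: eq_bigr => k _; congr (_ * block_weight _ _).
by move/seq.permP: st; exact.
Qed.

Lemma weight_relabel_perm (R : realType) (x a : R) (n : nat) (g : 'S_n)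
    (z : n.-tuple 'I_n.+1) :
  weight x a (map val (relabel_perm n g z)) = weight x a (map val z).
Proof.
rewrite val_relabel_perm weight_relabel; apply: weight_perm.
exact: perm_map_val_tnth.
Qed.

Lemma relabel_permK (n : nat) (g h : 'S_n) (z : n.-tuple 'I_n.+1) :
  cancel g h ->
  map val (relabel_perm n g (relabel_perm n h z)) = relabel (map val z).
Proof.
move=> gK; rewrite val_relabel_perm.
under eq_map do rewrite tnth_relabel_perm gK.
rewrite (map_comp (label _)) map_val_tnth; apply: relabel_map_in.
move=> u v; rewrite -!(perm_mem (perm_map_val_tnth _ _ h z)) => us vs.
exact: label_inj.
Qed.

(** The round trip amounts to a single relabelling, which fixes exactly the valid sequences; on
    these [relabel_perm] is therefore a bijection. *)
Lemma relabel_perm_id (n : nat) (g h : 'S_n) (z : n.-tuple 'I_n.+1) :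
  cancel g h ->
  (relabel_perm n g (relabel_perm n h z) == z) = appearance_order (map val z).
Proof.
move=> gK; apply/eqP/idP => [<-|zA].
  by rewrite val_relabel_perm appearance_order_relabel.
by apply: val_inj; apply: (inj_map val_inj); rewrite /= relabel_permK// relabel_id.
Qed.

(** Reindexing along this bijection keeps the weight and moves the compared positions from i, j to g
    i, g j. *)
Lemma sum_weight_neq_perm (R : realType) (x a : R) (n : nat) (g : 'S_n)
    (i j : 'I_n) :
  \sum_(z : n.-tuple 'I_n.+1 | appearance_order (map val z)
                                && (tnth z i != tnth z j))
     weight x a (map val z) =
  \sum_(z : n.-tuple 'I_n.+1 | appearance_order (map val z)
                                && (tnth z (g i) != tnth z (g j)))
     weight x a (map val z).
Proof.
have gK : cancel g (g^-1)%g by exact: permK.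
have gV : cancel (g^-1)%g g by exact: permKV.
rewrite (reindex_onto (relabel_perm n g) (relabel_perm n (g^-1)%g)); last first.
  by move=> z /andP[zA _]; apply/eqP; rewrite relabel_perm_id.
apply: eq_big => z; last by move=> _; rewrite weight_relabel_perm.
rewrite relabel_perm_id// eq_tnth_relabel_perm val_relabel_perm.
by rewrite appearance_order_relabel /= andbC.
Qed.

Lemma perm_two_points (n : nat) (i j k l : 'I_n) : i != j -> k != l ->
  exists g : 'S_n, g i = k /\ g j = l.
Proof.
(* The first transposition sends i to k; the second sends the image of j to l and fixes k, which
   differs from both [h j] and [l]. *)
move=> ij kl; pose h := tperm i k.
have hj : h j != k by rewrite -(tpermL i k) (inj_eq perm_inj) eq_sym.
exists (h * tperm (h j) l)%g; rewrite !permM tpermL tpermL; split => //.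
by rewrite tpermD// eq_sym.
Qed.

Lemma sum_weight_neq (R : realType) (x a : R) (n : nat) (i j k l : 'I_n) :
  i != j -> k != l ->
  \sum_(z : n.-tuple 'I_n.+1 | appearance_order (map val z)
                                && (tnth z i != tnth z j))
     weight x a (map val z) =
  \sum_(z : n.-tuple 'I_n.+1 | appearance_order (map val z)
                                && (tnth z k != tnth z l))
     weight x a (map val z).
Proof.
move=> ij kl; have [g [<- <-]] := perm_two_points _ _ _ _ _ ij kl.
exact: sum_weight_neq_perm.
Qed.

(** Order of appearance forces two distinct initial labels to be 1 and 2. This prefix has weight
    x^2, two points and two clusters, and [d] points remain to be appended. *)
Lemma sum_weight_neq12 (R : realType) (gamma0 a p : R) (d : nat) :
  let x := gamma0 * p `^ (- a) in
  \sum_(z : d.+2.-tuple 'I_d.+3 | appearance_order (map val z)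
           && (nth 0%N (map val z) 0 != nth 0%N (map val z) 1))
     weight x a (map val z) = x ^+ 2 * Rrec gamma0 a p d 2 2.
Proof.
move=> x.
rewrite (big_tupleS _ _ _ (fun z => appearance_order (map val z)
   && (nth 0%N (map val z) 0 != nth 0%N (map val z) 1))
  (fun z => weight x a (map val z))).
under eq_bigr => y _.
  rewrite (big_tupleS _ _ _ (fun z => appearance_order (map val (y :: z))
     && (nth 0%N (map val (y :: z)) 0 != nth 0%N (map val (y :: z)) 1))
    (fun z => weight x a (map val (y :: z)))).
  over.
have app12 (y k : 'I_d.+3) (t : seq 'I_d.+3) :
    appearance_order (map val [:: y, k & t]) && (val y != val k) ->
    val y = 1%N /\ val k = 2%N.
  rewrite (_ : map val _ = [:: val y; val k] ++ map val t)//.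
  move=> /andP[/appearance_order_cat]; rewrite /appearance_order /= in_cons.
  rewrite in_nil orbF eq_sym => /and3P[/eqP ->].
  by case: eqVneq => //= _ /eqP ->.
have h1 : (1 < d.+3)%N by []. have h2 : (2 < d.+3)%N by [].
rewrite (bigD1 (Ordinal h1))//= [X in _ + X]big1 ?addr0; last first.
  move=> y y1; rewrite big1// => k _; rewrite big1// => t /app12[yE _].
  by move: y1; rewrite -val_eqE /= yE eqxx.
rewrite (bigD1 (Ordinal h2))//= [X in _ + X]big1 ?addr0; last first.
  move=> k k2; rewrite big1// => t /(app12 (Ordinal h1) k)[_ kE].
  by move: k2; rewrite -val_eqE /= kE eqxx.
under eq_bigl do rewrite andbT.
have := @sum_weight_ext R gamma0 a p d.+3 d [:: 1; 2]%N isT.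
rewrite -/x => /(_ (ltnSn _)) ->.
congr (_ * _); rewrite /weight /= !big_cons big_nil /block_weight !big_ord0.
by rewrite !mulr1.
Qed.

(** * The sampling formula and the gNB mass function in terms of weights *)

Lemma Gamma_block_weight (R : realType) (a : R) (m : nat) : a < 1 -> (0 < m)%N ->
  Gamma (m%:R - a) / Gamma (1 - a) = block_weight a m.
Proof. by case: m => // m a1 _; rewrite Gamma_ratio. Qed.

Lemma cluster_factorE (R : realType) (gamma0 a p : R) (l : nat) :
  gamma0 ^+ l * p `^ (- a * l%:R) = (gamma0 * p `^ (- a)) ^+ l.
Proof. by rewrite powRrM powR_mulrn ?powR_ge0// exprMn. Qed.

(** In a valid sequence the labels that occur are exactly 1, ..., l, so the two products have the
    same factors up to order. *)
Lemma gCRSF_weight (R : realType) (gamma0 a p : R) (z : seq nat) : a < 1 ->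
  gCRSF gamma0 a p z =
  if appearance_order z then
    weight (gamma0 * p `^ (- a)) a z / gen_total gamma0 a p (size z)
  else 0.
Proof.
move=> a1; rewrite /gCRSF; case: ifP => // zA.
rewrite cluster_factorE /weight [in RHS]big_split/=.
rewrite big_const_seq count_predT iter_mulr_1.
rewrite mulrAC; congr (_ * _ / _).
rewrite (perm_big _ (perm_undup_iota _ zA)) /index_iota subSS subn0.
apply: eq_big_seq => k; rewrite -mem_appearance_order// => kz.
by rewrite Gamma_block_weight// -has_count has_pred1.
Qed.

Lemma genStirling_term_ge0 (R : realType) (a : R) (n l : nat)
    (c : l.-tuple 'I_n.+1) : a < 1 -> [forall k, 0 < tnth c k]%N ->
  0 <= \prod_(k < l)
    (Gamma ((tnth c k : nat)%:R - a) / ((tnth c k)`!%:R * Gamma (1 - a))).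
Proof.
move=> a1 /forallP cpos; apply: prodr_ge0 => k _.
rewrite divr_ge0 ?mulr_ge0 ?ler0n ?ltW ?Gamma_gt0//.
  by rewrite subr_gt0 (lt_le_trans a1)// ler1n cpos.
by rewrite subr_gt0.
Qed.

Lemma genStirling_ge0 (R : realType) (a : R) (n l : nat) : a < 1 ->
  0 <= genStirling a n l.
Proof.
move=> a1; rewrite mulr_ge0//; apply: sumr_ge0 => c /andP[cpos _].
exact: genStirling_term_ge0.
Qed.

(** The only block is the whole sample: [ord_max] is the part of size [n]. *)
Lemma genStirling1_gt0 (R : realType) (a : R) (n : nat) : a < 1 -> (0 < n)%N ->
  0 < genStirling a n 1.
Proof.
move=> a1 n0; rewrite mulr_gt0 ?divr_gt0 ?ltr0n ?fact_gt0//.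
rewrite (bigD1 [tuple ord_max])/=; last first.
  apply/andP; split; last by rewrite big_ord1 (tnth_nth ord_max).
  by apply/forallP => k; rewrite ord1 (tnth_nth ord_max).
rewrite ltr_pwDl//.
  rewrite big_ord1 (tnth_nth ord_max)/= divr_gt0 ?mulr_gt0 ?ltr0n ?fact_gt0//.
  - by rewrite Gamma_gt0// subr_gt0 (lt_le_trans a1)// ler1n.
  - by rewrite Gamma_gt0// subr_gt0.
apply: sumr_ge0 => c /andP[/andP[cpos _] _].
exact: genStirling_term_ge0.
Qed.

Lemma gen_total0 (R : realType) (gamma0 a p : R) : gen_total gamma0 a p 0 = 1.
Proof.
rewrite /gen_total big_nat1 expr0 mulr0 powRr0 !mul1r /genStirling divff//.
rewrite mul1r (big_pred1 [tuple]) ?big_ord0// => c.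
apply/andP/eqP => [_|->]; first by rewrite tuple0.
by split; [apply/forallP => -[]|rewrite big_ord0].
Qed.

Lemma gen_total1 (R : realType) (gamma0 a p : R) : a < 1 ->
  gen_total gamma0 a p 1 = gamma0 * p `^ (- a).
Proof.
move=> a1; rewrite /gen_total big_nat_recl// big_nat1.
have -> : genStirling a 1 0 = 0.
  rewrite /genStirling big_pred0 ?mulr0// => c.
  by rewrite big_ord0 andbF.
have -> : genStirling a 1 1 = 1.
  rewrite /genStirling divff// mul1r (big_pred1 [tuple ord_max]); last first.
    move=> c; rewrite big_ord1; apply/andP/eqP => [[_ /eqP c1]|->].
      apply: eq_from_tnth => k; rewrite ord1; apply: val_inj.
      by rewrite [in RHS](tnth_nth ord_max); exact: c1.
    split; last by rewrite (tnth_nth ord_max).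
    by apply/forallP => k; rewrite ord1 (tnth_nth ord_max).
  rewrite big_ord1 (tnth_nth ord_max)/= mul1r divff// gt_eqF// Gamma_gt0//.
  by rewrite subr_gt0.
by rewrite mulr0 add0r !mulr1 expr1.
Qed.

(** For n >= 1 the term l = 1 is positive and the others are nonnegative. This permits cancelling
    the normalisation. *)
Lemma gen_total_gt0 (R : realType) (gamma0 a p : R) (n : nat) :
  a < 1 -> 0 < p -> 0 < gamma0 -> 0 < gen_total gamma0 a p n.
Proof.
move=> a1 p0 g0; case: n => [|n]; first by rewrite gen_total0.
rewrite /gen_total big_nat_recl// big_nat_recl//.
have ge0 l m : 0 <= gamma0 ^+ l * p `^ (- a * l%:R) * genStirling a m l.
  apply: mulr_ge0; last exact: genStirling_ge0.
  by rewrite mulr_ge0 ?powR_ge0 ?exprn_ge0 ?ltW.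
apply: ltr_wpDl; first exact: ge0.
apply: ltr_pwDl; last by apply: sumr_ge0 => l _; exact: ge0.
apply: mulr_gt0; last exact: genStirling1_gt0.
by rewrite mulr_gt0 ?powR_gt0 ?exprn_gt0.
Qed.

Lemma gCRSF_neq12E (R : realType) (gamma0 a p : R) (n : nat) :
  a < 1 -> (1 < n)%N ->
  gCRSF_neq12 gamma0 a p n =
  (gamma0 * p `^ (- a)) ^+ 2 * Rcoef gamma0 a p n 2 2 / gen_total gamma0 a p n.
Proof.
case: n => [|[|d]]// a1 _; rewrite /Rcoef !subSS subn0 -sum_weight_neq12.
rewrite mulr_suml /gCRSF_neq12 big_mkcond [RHS]big_mkcond/=.
apply: eq_bigr => z _; rewrite gCRSF_weight// size_map size_tuple andbC.
by case: (appearance_order _); case: (nth _ _ _ != _).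
Qed.

Lemma gNB0 (R : realType) (gamma0 a p : R) :
  gNB gamma0 a p 0 = expR (- gamma0 * gNB_rate a p).
Proof. by rewrite /gNB gen_total0 fact0 expr0 divff// mul1r mulr1. Qed.

Lemma gNB1 (R : realType) (gamma0 a p : R) : a < 1 -> 0 < p ->
  gNB gamma0 a p 1 =
  gamma0 * p `^ (1 - a) * expR (- gamma0 * gNB_rate a p).
Proof.
move=> a1 p0; rewrite /gNB gen_total1// expr1 divr1 powRD; last first.
  by rewrite (gt_eqF p0) implybT.
by rewrite powRr1 ?ltW//; ring.
Qed.

Lemma gCRSF_neq12_gNB (R : realType) (gamma0 a p : R) (n : nat) :
  a < 1 -> 0 < p -> 0 < gamma0 -> (1 < n)%N ->
  gCRSF_neq12 gamma0 a p n * gNB gamma0 a p n =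
  gamma0 ^+ 2 * p `^ (- 2%:R * a) * expR (- gamma0 * gNB_rate a p)
  * (p ^+ n / n`!%:R * Rcoef gamma0 a p n 2 2).
Proof.
move=> a1 p0 g0 n1; rewrite gCRSF_neq12E// /gNB.
have T0 : gen_total gamma0 a p n != 0 by rewrite gt_eqF// gen_total_gt0.
have n0 : n`!%:R != 0 :> R by rewrite pnatr_eq0 -lt0n fact_gt0.
rewrite -cluster_factorE (_ : - a * 2%:R = - 2%:R * a); last by ring.
by field; rewrite T0 n0.
Qed.

(** * The exponential generating function of Rrec *)

(** The polynomial of degree below [N]: the inequalities are proved for these truncations, uniformly
    in [N], and only then passed to the limit. *)
Definition egf_sum {R : realType} (r : nat -> R) (N : nat) (t : R) : R :=
  \sum_(k < N) t ^+ k / k`!%:R * r k.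

Lemma egf_sumS (R : realType) (r : nat -> R) (N : nat) (t : R) :
  egf_sum r N.+1 t = egf_sum r N t + t ^+ N / N`!%:R * r N.
Proof. by rewrite /egf_sum big_ord_recr. Qed.

Lemma egf_sum0 (R : realType) (r : nat -> R) (N : nat) :
  egf_sum r N.+1 0 = r 0%N.
Proof.
rewrite /egf_sum big_ord_recl big1 ?addr0 ?fact0 ?divr1 ?mul1r// => k _.
by rewrite expr0n !mul0r.
Qed.

Lemma is_derive_egf_sum (R : realType) (r : nat -> R) (N : nat) (t : R) :
  is_derive t 1 (egf_sum r N.+1) (egf_sum (fun k => r k.+1) N t).
Proof.
elim: N => [|N IH].
  rewrite (_ : egf_sum r 1 = cst (r 0%N)); last first.
    by apply/funext => u; rewrite /egf_sum big_ord1 fact0 divr1 mul1r.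
  by rewrite /egf_sum big_ord0; exact: is_derive_cst.
rewrite (_ : egf_sum r N.+2 =
    egf_sum r N.+1 + (r N.+1 / N.+1`!%:R) *: (@id R ^+ N.+1)); last first.
  apply/funext => u; rewrite egf_sumS; congr (_ + _).
  by rewrite /= fctE mulrC mulrA mulrAC.
rewrite egf_sumS; apply: is_deriveD => //; apply: is_derive_eq.
rewrite factS natrM /GRing.scale /= mulr1.
have n0 : N`!%:R != 0 :> R by rewrite pnatr_eq0 -lt0n fact_gt0.
by field; rewrite n0 ?natr1 ?nat1r pnatr_eq0.
Qed.

Lemma Rrec_coef_ge0 (R : realType) (a : R) (i j : nat) : a < 1 -> (j <= i)%N ->
  0 <= i%:R - a * j%:R.
Proof.
move=> a1 ji; rewrite (_ : _ - _ = (i%:R - j%:R) + (1 - a) * j%:R); last by ring.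
by rewrite addr_ge0 ?mulr_ge0// subr_ge0 ?ler_nat// ltW.
Qed.

Lemma Rrec_ge0 (R : realType) (gamma0 a p : R) (d i j : nat) :
  a < 1 -> 0 < gamma0 -> (j <= i)%N -> 0 <= Rrec gamma0 a p d i j.
Proof.
move=> a1 g0; elim: d i j => //= d IH i j ji.
rewrite addr_ge0// mulr_ge0 ?IH ?Rrec_coef_ge0 ?mulr_ge0 ?powR_ge0 ?(ltW g0)//.
exact: leqW.
Qed.

(** The function is e^(X u) (1 - u)^(-c). It serves as the majorant of the generating functions and,
    with X = 0 and -c for c, as the factor (1 - u)^c at a = 0. *)
Lemma is_derive_expR_ln (R : realType) (c X t : R) : t < 1 ->
  is_derive t 1 (fun u => expR (X * u - c * ln (1 - u)))
    (expR (X * t - c * ln (1 - t)) * (X + c / (1 - t))).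
Proof.
move=> t1; apply: is_derive1_comp.
have h : is_derive t 1 (fun u => ln (1 - u)) ((1 - t)^-1 * - 1).
  apply: (@is_derive1_comp _ (@ln R) (fun u => 1 - u)).
    by apply: is_derive1_ln; rewrite subr_gt0.
  have h1 : is_derive t 1 (cst (1 : R) - @id R) (0 - 1) by apply: is_deriveB.
  by rewrite sub0r in h1; exact: h1.
rewrite (_ : (fun u => _) = X *: @id R - c *: (fun u => ln (1 - u))); last first.
  by apply/funext.
apply: is_derive_eq; rewrite /GRing.scale /=.
by rewrite mulr1 mulrN1 mulrN opprK.
Qed.

(** The mean value theorem applied to g - f. *)
Lemma le_of_derive_le (R : realType) (f g f' g' : R -> R) (q : R) : 0 <= q ->
  (forall t, 0 <= t <= q -> is_derive t 1 f (f' t)) ->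
  (forall t, 0 <= t <= q -> is_derive t 1 g (g' t)) ->
  (forall t, 0 <= t <= q -> f' t <= g' t) ->
  f 0 <= g 0 -> f q <= g q.
Proof.
move=> q0 df dg le' le0; rewrite -subr_ge0.
have dh t : 0 <= t <= q -> is_derive t 1 (g - f) (g' t - f' t).
  by move=> tq; apply: is_deriveB; [exact: dg|exact: df].
have [||c cq] := @MVT_segment R (g - f) (fun t => g' t - f' t) 0 q q0.
- by move=> t tq; apply: dh; have := subset_itv_oo_cc tq; rewrite /= in_itv.
- apply: derivable_within_continuous => t; rewrite in_itv/= => tq.
  by have [] := dh _ tq.
rewrite subr0 /= => /eqP; rewrite subr_eq => /eqP.
rewrite (_ : (g - f) q = g q - f q)// => ->; rewrite addr_ge0 ?mulr_ge0//.
  by rewrite subr_ge0 le'//; move: cq; rewrite in_itv.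
by rewrite (_ : (g - f) 0 = g 0 - f 0)// subr_ge0.
Qed.

(* The generating function of d |-> Rrec d i j is
   (1 - t)^(a j - i) * exp (x phi) with phi' = (1 - t)^(a - 1); on [0, q] this
   derivative is at most its value at q. *)
Lemma egf_sum_Rrec_le (R : realType) (gamma0 a p q : R) (N i j : nat) (t : R) :
  let X := gamma0 * p `^ (- a) * expR (- (1 - a) * ln (1 - q)) in
  a < 1 -> 0 < gamma0 -> q < 1 -> (j <= i)%N -> 0 <= t <= q ->
  egf_sum (fun d => Rrec gamma0 a p d i j) N t <=
  expR (X * t - (i%:R - a * j%:R) * ln (1 - t)).
Proof.
move=> X a1 g0 q1; elim: N i j t => [|N IH] i j t ji tq.
  by rewrite /egf_sum big_ord0 expR_ge0.
pose c : R := i%:R - a * j%:R.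
have t1 u : 0 <= u <= t -> u < 1.
  move=> /andP[_ ut]; apply: le_lt_trans q1; apply: (le_trans ut).
  by case/andP: tq.
apply: (@le_of_derive_le _ _ (fun t => expR (X * t - c * ln (1 - t)))
  (egf_sum (fun d => Rrec gamma0 a p d.+1 i j) N)
  (fun t => expR (X * t - c * ln (1 - t)) * (X + c / (1 - t)))).
- by case/andP: tq.
- by move=> u _; exact: is_derive_egf_sum.
- by move=> u ut; apply: is_derive_expR_ln; exact: t1.
- move=> u ut; have u1 := t1 _ ut.
  have uq : 0 <= u <= q.
    by case/andP: ut tq => -> /le_trans h /andP[_ /h].
  have x0 : 0 <= gamma0 * p `^ (- a) by rewrite mulr_ge0 ?powR_ge0 ?ltW.
  have -> : egf_sum (fun d => Rrec gamma0 a p d.+1 i j) N u =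
      egf_sum (fun d => Rrec gamma0 a p d i.+1 j) N u * c +
      egf_sum (fun d => Rrec gamma0 a p d i.+1 j.+1) N u * (gamma0 * p `^ (- a)).
    rewrite /egf_sum !mulr_suml -big_split/=; apply: eq_bigr => k _.
    by rewrite mulrDr !mulrA.
  rewrite [leLHS]addrC [leRHS]mulrDr; apply: lerD.
    (* Raising both indices raises [c] by 1 - a; the extra factor (1 - u)^(a - 1) is at most its
       value at [q], which [X] contains. *)
    have /(ler_wpM2r x0) h := IH i.+1 j.+1 u ji uq.
    apply: (le_trans h); rewrite (_ : X * u - (i.+1%:R - a * j.+1%:R) * _ =
      (X * u - c * ln (1 - u)) + (- (1 - a) * ln (1 - u))); last first.
      by rewrite -(natr1 i) -(natr1 j) /c; ring.
    rewrite expRD -mulrA ler_wpM2l ?expR_ge0// mulrC ler_wpM2l//.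
    rewrite ler_expR ler_wnM2l ?oppr_le0 ?subr_ge0 ?(ltW a1)//.
    rewrite ler_ln ?posrE ?subr_gt0// lerD2l lerN2.
    by case/andP: uq.
  have c0 : 0 <= c by exact: Rrec_coef_ge0.
  (* Raising only the first index raises [c] by 1, and the extra factor is exactly 1 / (1 - u). *)
  have /(ler_wpM2r c0) h := IH i.+1 j u (leqW ji) uq.
  apply: (le_trans h); rewrite (_ : X * u - (i.+1%:R - a * j%:R) * _ =
    (X * u - c * ln (1 - u)) - ln (1 - u)); last first.
    by rewrite -(natr1 i) /c; ring.
  rewrite expRB lnK ?posrE ?subr_gt0//.
  by rewrite -!mulrA [_^-1 * c]mulrC.
rewrite egf_sum0/=; rewrite mulr0 subr0 ln1 mulr0 subr0 expR0.
by [].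
Qed.

Lemma egf_sum_is_cvg (R : realType) (gamma0 a p q : R) (i j : nat) :
  a < 1 -> 0 < gamma0 -> 0 <= q < 1 -> (j <= i)%N ->
  cvgn (fun N => egf_sum (fun d => Rrec gamma0 a p d i j) N q).
Proof.
move=> a1 g0 /andP[q0 q1] ji; apply: nondecreasing_is_cvgn.
  apply/nondecreasing_seqP => N; rewrite egf_sumS lerDl.
  by rewrite mulr_ge0 ?Rrec_ge0 ?divr_ge0 ?exprn_ge0.
eexists => _ [N _ <-]; apply: (egf_sum_Rrec_le _ _ _ _ q) => //.
by rewrite q0 lexx.
Qed.

Lemma Rcoef_term_ge0 (R : realType) (gamma0 a p : R) (n : nat) :
  a < 1 -> 0 < gamma0 -> 0 <= p ->
  0 <= p ^+ n / n`!%:R * Rcoef gamma0 a p n 2 2.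
Proof. by move=> a1 g0 p0; rewrite mulr_ge0 ?divr_ge0 ?exprn_ge0 ?Rrec_ge0. Qed.

Lemma nondecreasing_sum_Rcoef (R : realType) (gamma0 a p : R) :
  a < 1 -> 0 < gamma0 -> 0 <= p ->
  nondecreasing_seq
    (fun N => \sum_(2 <= n < N) p ^+ n / n`!%:R * Rcoef gamma0 a p n 2 2).
Proof.
move=> a1 g0 p0; apply/nondecreasing_seqP => N; have [N2|N2] := leqP 2 N.
  by rewrite [leRHS]big_nat_recr//= lerDl Rcoef_term_ge0.
rewrite [leLHS]big_geq ?(ltnW N2)// sumr_ge0// => n _; exact: Rcoef_term_ge0.
Qed.

Lemma egf_Rcoef_is_cvg (R : realType) (gamma0 a p : R) :
  a < 1 -> 0 < gamma0 -> 0 < p < 1 ->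
  cvgn (fun N => \sum_(2 <= n < N) p ^+ n / n`!%:R * Rcoef gamma0 a p n 2 2).
Proof.
move=> a1 g0 /andP[p0 p1]; apply: nondecreasing_is_cvgn.
  exact: nondecreasing_sum_Rcoef (ltW p0).
eexists => _ [N _ <-].
(* With n = d + 2, p^n / n! is at most p^d / d!, which reduces the bound to the generating function
   in [d]. *)
apply: (@le_trans _ _ (egf_sum (fun d => Rrec gamma0 a p d 2 2) (N - 2) p)).
  rewrite -{1}[2%N]add0n big_addn big_mkord; apply: ler_sum => d _.
  rewrite /Rcoef addnK ler_wpM2r ?Rrec_ge0//.
  rewrite ler_pM ?exprn_ge0 ?invr_ge0 ?(ltW p0)//.
    by rewrite exprD ler_piMr ?exprn_ge0 ?exprn_ile1 ?ltW.
  by rewrite lef_pV2 ?posrE ?ltr0n ?fact_gt0// ler_nat leq_fact ?leq_addr.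
apply: (egf_sum_Rrec_le _ _ _ _ p) => //; by rewrite lexx ltW.
Qed.

Lemma nneseries_EFin (R : realType) (c : R) (u : nat -> R) :
  cvgn (fun N => \sum_(2 <= n < N) u n) ->
  (\sum_(2 <= n <oo) (c * u n)%:E)%E =
  (c * limn (fun N => \sum_(2 <= n < N) u n))%:E.
Proof.
move=> cu; rewrite (_ : (fun N => _) =
    EFin \o (fun N => c * \sum_(2 <= n < N) u n)); last first.
  by apply/funext => N; rewrite /= sumEFin mulr_sumr.
have cc : c * \sum_(2 <= n < N) u n @[N --> \oo] -->
    c * limn (fun N => \sum_(2 <= n < N) u n).
  by apply: cvgM => //; exact: cvg_cst.
by rewrite EFin_lim; [rewrite (cvg_lim _ cc)|apply/cvg_ex; eexists; exact: cc].
Qed.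

(** * Rising factorials and the negative binomial series *)

(** The Pochhammer symbol c (c + 1) ... (c + k - 1). *)
Definition rising {R : realType} (c : R) (k : nat) : R :=
  \prod_(m < k) (c + m%:R).

Lemma rising0 (R : realType) (c : R) : rising c 0 = 1.
Proof. exact: big_ord0. Qed.

Lemma risingS (R : realType) (c : R) (k : nat) :
  rising c k.+1 = rising c k * (c + k%:R).
Proof. by rewrite /rising big_ord_recr. Qed.

Lemma risingSl (R : realType) (c : R) (k : nat) :
  rising c k.+1 = c * rising (c + 1) k.
Proof.
rewrite /rising big_ord_recl addr0; congr (_ * _); apply: eq_bigr => m _.
by rewrite -addrA nat1r.
Qed.

(** At a = 0 the value does not depend on [j], so the two terms of the recursion merge into the
    single factor gamma0 + i. *)
Lemma Rrec_a0 (R : realType) (gamma0 p : R) (d i j : nat) :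
  Rrec gamma0 0 p d i j = rising (gamma0 + i%:R) d.
Proof.
elim: d i j => [|d IH] i j /=; first by rewrite /rising big_ord0.
rewrite !IH oppr0 powRr0 risingSl -(natr1 i) addrA; ring.
Qed.

(** The equation (1 - t) f' = c f of f = (1 - t)^(-c), with the defect caused by truncation on the
    right. *)
Lemma rising_ode (R : realType) (c t : R) (N : nat) :
  (1 - t) * egf_sum (fun k => rising c k.+1) N t - c * egf_sum (rising c) N.+1 t
  = - (t ^+ N / N`!%:R * rising c N.+1).
Proof.
elim: N => [|N IH].
  rewrite /egf_sum big_ord0 big_ord1 /rising big_ord0 big_ord1 fact0 divr1.
  by rewrite expr0 addr0; ring.
rewrite egf_sumS [egf_sum (rising c) _ _]egf_sumS mulrDr mulrDr opprD addrACA.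
rewrite IH (risingS _ _ N.+1) factS natrM exprS.
have n0 : N`!%:R != 0 :> R by rewrite pnatr_eq0 -lt0n fact_gt0.
have n1 : N.+1%:R != 0 :> R by rewrite pnatr_eq0.
by rewrite -(natr1 N) in n1 *; field; rewrite n0.
Qed.

Lemma cvg_rising_term (R : realType) (c p : R) : 0 < c -> 0 <= p < 1 ->
  p ^+ N / N`!%:R * rising c N.+1 @[N --> \oo] --> 0.
Proof.
move=> c0 p01.
(* The parameters gamma0 = c, a = 0, i = 1 turn [Rrec] into [rising (c + 1)]; the terms of the
   resulting convergent series tend to 0. *)
have h := @egf_sum_is_cvg R c 0 1 p 1 0 ltr01 c0 p01 isT.
have {}h : cvgn (series (fun k => p ^+ k / k`!%:R * rising (c + 1) k)).
  rewrite (_ : series _ = fun N => egf_sum (fun d => Rrec c 0 1 d 1 0) N p)//.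
  apply/funext => N; rewrite /series/= big_mkord; apply: eq_bigr => k _.
  by rewrite Rrec_a0.
have {}h := cvg_series_cvg_0 h.
rewrite (_ : (fun N => _) =
  (fun N => c * (p ^+ N / N`!%:R * rising (c + 1) N))); last first.
  by apply/funext => N; rewrite risingSl; ring.
have hc : c @[N --> \oo] --> c by exact: cvg_cst.
by have := cvgM hc h; rewrite mulr0; apply.
Qed.

(* With P the degree N Taylor polynomial, (1 - t)^c P(t) has derivative
   - (1 - t)^(c - 1) t^N / N! rising c N.+1. *)
Lemma egf_sum_rising_dist (R : realType) (c p : R) (N : nat) :
  0 < c -> 0 < p < 1 ->
  `| expR (c * ln (1 - p)) * egf_sum (rising c) N.+1 p - 1 | <=
  p / (1 - p) * (p ^+ N / N`!%:R * rising c N.+1).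
Proof.
move=> c0 /andP[p0 p1].
pose u (t : R) := expR (0 * t - (- c) * ln (1 - t)) * egf_sum (rising c) N.+1 t.
pose du (t : R) := - (expR (c * ln (1 - t)) / (1 - t)
                * (t ^+ N / N`!%:R * rising c N.+1)).
have dE (t : R) : t < 1 -> is_derive t 1 u (du t).
  move=> t1.
  have h1 := @is_derive_expR_ln R (- c) 0 t t1.
  have h2 := @is_derive_egf_sum R (rising c) N t.
  have := @is_deriveM _ _ _ _ _ _ _ _ h1 h2.
  rewrite (_ : _ + _ = du t)//.
  rewrite /du -[t ^+ N / _ * _]opprK -rising_ode.
  rewrite /GRing.scale/= mul0r sub0r !mulNr opprK add0r.
  by field; rewrite subr_eq0 eq_sym lt_eqF.
have [||t tp] := @MVT_segment R u du 0 p (ltW p0).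
- move=> t; rewrite in_itv/= => /andP[_ tp]; apply: dE; exact: lt_trans p1.
- apply: derivable_within_continuous => t; rewrite in_itv/= => /andP[_ tp].
  by have [] := dE t (le_lt_trans tp p1).
rewrite /u egf_sum0 rising0 !mul0r !sub0r !mulNr !opprK.
rewrite subr0 ln1 mulr0 expR0 mulr1 subr0 => ->.
move: tp; rewrite in_itv/= => /andP[t0 tp].
have r0 : 0 <= rising c N.+1 by apply: prodr_ge0 => m _; rewrite addr_ge0// ltW.
have t1 : t < 1 by exact: le_lt_trans p1.
set e := expR _ / _; set B := t ^+ N / _ * _; set B' := p ^+ N / _ * _.
have e0 : 0 <= e by rewrite divr_ge0 ?expR_ge0 ?subr_ge0 ?(ltW t1).
have B0 : 0 <= B by rewrite mulr_ge0 ?divr_ge0 ?exprn_ge0.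
rewrite normrN ger0_norm; last first.
  by rewrite mulr_ge0 ?(ltW p0)// mulr_ge0.
(* At the mean value point t <= p, one has (1 - t)^c <= 1, 1 / (1 - t) <= 1 / (1 - p) and t^N <=
   p^N. *)
rewrite (_ : p / (1 - p) * B' = (1 - p)^-1 * B' * p); last by ring.
rewrite ler_wpM2r ?(ltW p0)// ler_pM//.
  rewrite -[leRHS]mul1r ler_pM ?expR_ge0 ?invr_ge0 ?subr_ge0 ?(ltW t1)//.
    by rewrite expR_le1 pmulr_rle0// ln_le0// lerBlDr lerDl.
  by rewrite lef_pV2 ?posrE ?subr_gt0// lerD2l lerN2.
rewrite ler_wpM2r// ler_wpM2r ?invr_ge0//.
by rewrite lerXn2r ?nnegrE ?(ltW p0).
Qed.

Lemma cvg_negative_binomial_series (R : realType) (c p : R) :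
  0 < c -> 0 < p < 1 ->
  egf_sum (rising c) N.+1 p @[N --> \oo] --> expR (- c * ln (1 - p)).
Proof.
move=> c0 p01; have [p0 p1] := andP p01.
pose E := expR (c * ln (1 - p)).
have E0 : E != 0 by rewrite gt_eqF// expR_gt0.
suff h : E * egf_sum (rising c) N.+1 p @[N --> \oo] --> (1 : R).
  have hE : E^-1 @[N --> \oo] --> E^-1 by exact: cvg_cst.
  have := cvgM hE h; rewrite mulr1 mulNr expRN => {}h.
  rewrite (_ : (fun N => _) =
    (fun N => E^-1 * (E * egf_sum (rising c) N.+1 p))) //.
    exact: h.
  by apply/funext => N; rewrite mulKf.
have h1 : (1 : R) @[N --> \oo] --> (1 : R) by exact: cvg_cst.
have hc : p / (1 - p) @[N --> \oo] --> p / (1 - p) by exact: cvg_cst.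
have p01' : 0 <= p < 1 by rewrite (ltW p0).
have h : p / (1 - p) * (p ^+ N / N`!%:R * rising c N.+1) @[N --> \oo] --> (0 : R).
  by have := cvgM hc (@cvg_rising_term R c p c0 p01'); rewrite mulr0; apply.
apply: (@squeeze_cvgr _ _ _ _
  (fun N => 1 - p / (1 - p) * (p ^+ N / N`!%:R * rising c N.+1))
  (fun N => 1 + p / (1 - p) * (p ^+ N / N`!%:R * rising c N.+1))).
- by near=> N; rewrite -ler_distlC distrC egf_sum_rising_dist.
- by have := cvgB h1 h; rewrite subr0; apply.
- by have := cvgD h1 h; rewrite addr0; apply.
Unshelve. all: by end_near.
Qed.

(** * Probabilities of events determined by the labels *)

Lemma measurable_countable_fibers (d : measure_display) (T : measurableType d)
    (C : countType) (f : T -> C) (Q : set C) :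
  (forall c, measurable (f @^-1` [set c])) -> measurable (f @^-1` Q).
Proof.
move=> mf; rewrite (_ : f @^-1` Q = \bigcup_(c in Q) f @^-1` [set c]); last first.
  by apply/seteqP; split => [w Qw|w [c Qc /= ->]//]; exists (f w).
rewrite bigcup_mkcond; apply: countable_bigcupT_measurable.
  exact: countableP.
by move=> c; case: ifP.
Qed.

(** The values of [f] outside the range of [h] are countably many and each is null, so together they
    form a null set [B]; the rest is a finite disjoint union. *)
Lemma measure_countable_fibers (d : measure_display) (T : measurableType d)
    (R : realType) (mu : measure T R) (C : countType) (K : finType)
    (f : T -> C) (h : K -> C) (E : set T) :
  (forall c, measurable (f @^-1` [set c])) -> measurable E -> injective h ->
  (forall c, (forall k, h k <> c) -> mu (E `&` f @^-1` [set c]) = 0%E) ->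
  mu E = (\sum_(k : K) mu (E `&` f @^-1` [set h k]))%E.
Proof.
move=> mf mE hI null.
pose B := E `&` f @^-1` (~` range h).
have mEf c : measurable (E `&` f @^-1` [set c]) by apply: measurableI.
have mB : measurable B.
  by apply: measurableI => //; exact: measurable_countable_fibers.
have B0 : mu B = 0%E.
  apply: measure_negligible => //.
  (* The null fibres are enumerated through the countable encoding of [C]. *)
  pose F k := if unpickle k is Some c then
    if `[< range h c >] then set0 else E `&` f @^-1` [set c] else set0.
  apply: (@negligibleS _ _ _ _ (\bigcup_k F k)).
    move=> w [Ew nw]; exists (pickle (f w)) => //; rewrite /F pickleK.
    by case: asboolP.
  apply: negligible_bigcup => k; rewrite /F.
  case: unpickle => [c|]; last exact: negligible_set0.
  case: asboolP => [_|nc]; first exact: negligible_set0.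
  apply/negligibleP => //; apply: null => k0 hk; apply: nc.
  by exists k0.
rewrite [in LHS](_ : E =
  (\bigcup_(k in [set` enum K]) (E `&` f @^-1` [set h k])) `|` B);
  last first.
  apply/seteqP; split => [w Ew|w [[k _ []]//|[]//]].
  have [[k _ hk]|nr] := pselect (range h (f w)); last by right.
  by left; exists k => //=; rewrite mem_enum.
rewrite measureU0//; last by apply: fin_bigcup_measurable.
rewrite measure_fin_bigcup//; last first.
  by move=> k l _ _ [w [[_ /= ->] [_ /= /hI]]].
by rewrite -fsbig_seq ?enum_uniq// big_enum.
Qed.

Lemma measurable_RV_fiber (d : measure_display) (T : measurableType d)
    (R : realType) (P : probability T R) (X : {RV P >-> nat}) (k : nat) :
  measurable (X @^-1` [set k]).
Proof. by rewrite -[X in measurable X]setTI; exact: measurable_funPT. Qed.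

Lemma measurable_neq_fibers (d : measure_display) (T : measurableType d)
    (g h : T -> nat) :
  (forall k, measurable (g @^-1` [set k])) ->
  (forall k, measurable (h @^-1` [set k])) ->
  measurable [set w | g w <> h w].
Proof.
move=> mg mh.
apply: (@measurable_countable_fibers _ _ _ (fun w => (g w, h w))
  [set c | c.1 <> c.2]) => -[k l].
rewrite (_ : _ @^-1` _ = g @^-1` [set k] `&` h @^-1` [set l]).
  exact: measurableI.
by apply/seteqP; split => [w [/= <- <-]//|w [/= <- <-]].
Qed.

Lemma measurable_random_index (d : measure_display) (T : measurableType d)
    (Z : nat -> T -> nat) (I : T -> nat) (k : nat) :
  (forall i l, measurable (Z i @^-1` [set l])) ->
  (forall l, measurable (I @^-1` [set l])) ->
  measurable ((fun w => Z (I w) w) @^-1` [set k]).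
Proof.
move=> mZ mI.
rewrite (_ : _ @^-1` _ = \bigcup_i (I @^-1` [set i] `&` Z i @^-1` [set k])).
  by apply: bigcup_measurable => i _; exact: measurableI.
apply/seteqP; split => [w /= Zk|w [i _ [/= -> //]]].
by exists (I w).
Qed.

Lemma tuple_fiberE (T : Type) (n : nat) (Z : nat -> T -> nat) (z : n.-tuple nat) :
  (fun w => [tuple Z i w | i < n]) @^-1` [set z] =
  [set w | forall k : 'I_n, Z k w = tnth z k].
Proof.
apply/seteqP; split => [w /= <- k|w /= h]; first by rewrite tnth_mktuple.
by apply: eq_from_tnth => k; rewrite tnth_mktuple.
Qed.

Lemma measurable_tuple_fiber (d : measure_display) (T : measurableType d)
    (n : nat) (Z : nat -> T -> nat) (z : n.-tuple nat) :
  (forall i l, measurable (Z i @^-1` [set l])) ->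
  measurable ((fun w => [tuple Z i w | i < n]) @^-1` [set z]).
Proof.
move=> mZ; rewrite tuple_fiberE.
rewrite (_ : [set w | _] =
  \bigcap_(k in [set: 'I_n]) (Z k @^-1` [set tnth z k])).
  by apply: fin_bigcap_measurable => //; exact: finite_finset.
by apply/seteqP; split => [w /= h k _|w h k] //=; exact: h.
Qed.

(** Labels in order of appearance are bounded by the number of clusters, hence by [n]. *)
Lemma gCRSF_out_of_range (R : realType) (gamma0 a p : R) (n : nat)
    (z : n.-tuple nat) :
  (forall y : n.-tuple 'I_n.+1, map_tuple val y <> z) -> gCRSF gamma0 a p z = 0.
Proof.
move=> nz; rewrite /gCRSF; case: ifPn => // zA.
have zn k : k \in val z -> (k < n.+1)%N.
  rewrite mem_appearance_order// mem_iota add1n => /andP[_ /leq_trans]; apply.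
  by rewrite ltnS -[X in (_ <= X)%N](size_tuple z) size_undup.
case: (nz (map_tuple inord z)); apply: val_inj => /=.
rewrite -map_comp -[RHS]map_id; apply/eq_in_map => k kz /=.
by rewrite inordK// zn.
Qed.

(** The event is split along the values of the first [n] labels: on each fibre it is either empty or
    all of N = n, and label tuples out of range carry no mass. *)
Lemma sampling_neq12 (d : measure_display) (T : measurableType d) (R : realType)
    (P : probability T R) (gamma0 a p : R) (N : {RV P >-> nat})
    (Z : nat -> {RV P >-> nat}) (I J : {RV P >-> nat}) (n : nat) :
  gCRSF_sampling gamma0 a p N Z I J -> (2 <= n)%N ->
  P [set w | N w = n /\ Z 0%N w <> Z 1%N w] =
  (gNB gamma0 a p n * gCRSF_neq12 gamma0 a p n)%:E.
Proof.
move=> [hN hZ _] n2.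
have mZ i l := @measurable_RV_fiber _ _ _ P (Z i) l.
have tfE (z : n.-tuple nat) : (fun w => [tuple Z i w | i < n]) @^-1` [set z] =
    [set w | forall k : 'I_n, Z k w = tnth z k].
  exact: (tuple_fiberE T n (fun i => Z i)).
have n0 : (0 < n)%N by apply: leq_trans n2.
pose E := [set w | N w = n /\ Z 0%N w <> Z 1%N w].
have mE : measurable E.
  apply: measurableI; first exact: measurable_RV_fiber.
  exact: measurable_neq_fibers.
have fib (z : n.-tuple nat) :
    P (E `&` (fun w => [tuple Z i w | i < n]) @^-1` [set z]) =
    (if nth 0%N z 0 != nth 0%N z 1 then gNB gamma0 a p n * gCRSF gamma0 a p z
     else 0)%:E.
  rewrite tfE.
  have tE w i (ilt : (i < n)%N) : (forall k : 'I_n, Z k w = tnth z k) ->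
      Z i w = nth 0%N z i.
    by move=> /(_ (Ordinal ilt)); rewrite (tnth_nth 0%N).
  case: eqVneq => [z01|/eqP z01].
    rewrite (_ : _ `&` _ = set0) ?measure0//; apply/seteqP; split => // w.
    by move=> [[_ +] /= zw]; rewrite (tE w 0%N n0 zw) (tE w 1%N n2 zw).
  rewrite EFinM -hN -hZ//; congr (P _); apply/seteqP; split => w /=.
    by move=> [[]].
  move=> [Nw zw]; do !split => //.
  by rewrite (tE w 0%N n0 zw) (tE w 1%N n2 zw).
rewrite (@measure_countable_fibers _ _ _ P _ _ (fun w => [tuple Z i w | i < n])
  (fun y : n.-tuple 'I_n.+1 => map_tuple val y) E)//.
- rewrite (eq_bigr _ (fun y _ => fib (map_tuple val y))).
  rewrite sumEFin /gCRSF_neq12 mulr_sumr [in RHS]big_mkcond/=.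
  by congr (_%:E); apply: eq_bigr => y _.
- by move=> z; exact: (measurable_tuple_fiber _ T n (fun i => Z i)).
- by move=> y y' [] /(inj_map val_inj) /val_inj.
- move=> z /gCRSF_out_of_range z0; apply: (etrans (fib z)).
  by rewrite z0 mulr0 if_same.
Qed.

(** Exchangeability passes from weights to probabilities because the normalisation depends on [n]
    alone. *)
Lemma gCRSF_neq_pair (R : realType) (gamma0 a p : R) (n : nat) (i j : 'I_n) :
  a < 1 -> (2 <= n)%N -> i != j ->
  \sum_(z : n.-tuple 'I_n.+1 | tnth z i != tnth z j) gCRSF gamma0 a p (map val z)
  = gCRSF_neq12 gamma0 a p n.
Proof.
move=> a1 n2 ij; have n0 : (0 < n)%N by apply: leq_trans n2.
have E (k l : 'I_n) :
    \sum_(z : n.-tuple 'I_n.+1 | tnth z k != tnth z l)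
       gCRSF gamma0 a p (map val z) =
    (\sum_(z : n.-tuple 'I_n.+1 | appearance_order (map val z)
                                  && (tnth z k != tnth z l))
       weight (gamma0 * p `^ (- a)) a (map val z)) / gen_total gamma0 a p n.
  rewrite mulr_suml big_mkcond [RHS]big_mkcond/=; apply: eq_bigr => z _.
  rewrite gCRSF_weight// size_map size_tuple.
  by case: (appearance_order _); case: (_ != _).
have k01 : Ordinal n0 != Ordinal n2 by [].
rewrite E (sum_weight_neq _ _ _ _ _ _ _ _ ij k01) -E /gCRSF_neq12.
apply: eq_bigl => z; rewrite -val_eqE /= !(tnth_nth ord0)/=.
by rewrite !(nth_map ord0) ?size_tuple.
Qed.

Lemma sumr_offdiag (V : nmodType) (n : nat) (c : V) :
  \sum_(ij : 'I_n * 'I_n | ij.1 != ij.2) c = c *+ (n * n.-1).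
Proof.
rewrite -(pair_big_dep xpredT (fun i j : 'I_n => i != j) (fun _ _ => c))/=.
under eq_bigr => i _.
  rewrite sumr_const (eq_card (B := predC1 i)); last first.
    by move=> j; rewrite !inE eq_sym.
  rewrite cardC1 card_ord.
  over.
by rewrite sumr_const card_ord -mulrnA mulnC.
Qed.

(** The event is split along labels and chosen pair. Each of the n (n - 1) ordered pairs contributes
    the same separation probability, so the uniform average is that of the first two positions. *)
Lemma sampling_neqIJ (d : measure_display) (T : measurableType d) (R : realType)
    (P : probability T R) (gamma0 a p : R) (N : {RV P >-> nat})
    (Z : nat -> {RV P >-> nat}) (I J : {RV P >-> nat}) (n : nat) : a < 1 ->
  gCRSF_sampling gamma0 a p N Z I J -> (2 <= n)%N ->
  P [set w | N w = n /\ Z (I w) w <> Z (J w) w] =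
  (gNB gamma0 a p n * gCRSF_neq12 gamma0 a p n)%:E.
Proof.
move=> a1 [hN hZ hIJ] n2.
have nn0 : (n * n.-1)%:R != 0 :> R.
  by rewrite pnatr_eq0 muln_eq0 negb_or -!lt0n; case: (n) n2 => [|[]].
have mZ i l := @measurable_RV_fiber _ _ _ P (Z i) l.
have tfE (z : n.-tuple nat) : (fun w => [tuple Z i w | i < n]) @^-1` [set z] =
    [set w | forall k : 'I_n, Z k w = tnth z k].
  exact: (tuple_fiberE T n (fun i => Z i)).
have mI l := @measurable_RV_fiber _ _ _ P I l.
have mJ l := @measurable_RV_fiber _ _ _ P J l.
pose E := [set w | N w = n /\ Z (I w) w <> Z (J w) w].
have mE : measurable E.
  apply: measurableI; first exact: measurable_RV_fiber.
  by apply: measurable_neq_fibers => k;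
    exact: (measurable_random_index _ T (fun i => Z i)).
pose f w := ([tuple Z i w | i < n], (I w, J w)).
pose g (z : n.-tuple nat) (i j : nat) : R :=
  gNB gamma0 a p n * gCRSF gamma0 a p z *
  (if [&& (i < n)%N, (j < n)%N & i != j] then ((n * n.-1)%:R)^-1 else 0).
have atom z i j : P [set w | [/\ N w = n, forall k : 'I_n, Z k w = tnth z k,
                       I w = i & J w = j]] = (g z i j)%:E.
  by rewrite hIJ// hZ// hN -!EFinM.
have fE z i j : f @^-1` [set (z, (i, j))] =
    (fun w => [tuple Z i w | i < n]) @^-1` [set z]
      `&` (I @^-1` [set i] `&` J @^-1` [set j]).
  by apply/seteqP; split => [w [<- <- <-]//|w [/= <- [<- <-]]].
have mf c : measurable (f @^-1` [set c]).
  case: c => z [i j]; rewrite fE; apply: measurableI; last exact: measurableI.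
  exact: (measurable_tuple_fiber _ T n (fun i => Z i)).
have atomE z i j : [set w | [/\ N w = n, forall k : 'I_n, Z k w = tnth z k,
    I w = i & J w = j]] = N @^-1` [set n] `&` f @^-1` [set (z, (i, j))].
  rewrite fE tfE; apply/seteqP; split => w /=.
    by move=> [].
  by move=> [? [? []]].
have fib (z : n.-tuple nat) (i j : 'I_n) :
    P (E `&` f @^-1` [set (z, (val i, val j))]) =
    (if tnth z i != tnth z j then g z i j else 0)%:E.
  case: eqVneq => [zij|/eqP zij].
    rewrite fE tfE (_ : _ `&` _ = set0) ?measure0//.
    apply/seteqP; split => // w [[_ Zw] [zw [/= Iw Jw]]]; apply: Zw.
    by rewrite Iw Jw (zw i) (zw j).
  rewrite -atom atomE; congr (P _); apply/seteqP; split => w.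
    by move=> [[]].
  move=> [Nw fw]; split => //; split => //.
  move: fw; rewrite fE tfE => -[zw [/= -> ->]].
  by rewrite (zw i) (zw j).
rewrite (@measure_countable_fibers _ _ _ P _ _ f
  (fun y : n.-tuple 'I_n.+1 * ('I_n * 'I_n) =>
     (map_tuple val y.1, (val y.2.1, val y.2.2))) E)//.
- rewrite (eq_bigr _ (fun y _ => fib (map_tuple val y.1) y.2.1 y.2.2)).
  rewrite sumEFin; congr (_%:E).
  rewrite -(pair_big xpredT xpredT (fun (y : n.-tuple 'I_n.+1) (ij : 'I_n * 'I_n) =>
    if tnth (map_tuple val y) ij.1 != tnth (map_tuple val y) ij.2
    then g (map_tuple val y) ij.1 ij.2 else 0))/=.
  (* The labels are summed first, with the pair fixed; diagonal pairs contribute 0. *)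
  rewrite exchange_big/=.
  transitivity (\sum_(ij : 'I_n * 'I_n | ij.1 != ij.2)
      gNB gamma0 a p n / (n * n.-1)%:R * gCRSF_neq12 gamma0 a p n).
    rewrite [RHS]big_mkcond; apply: eq_bigr => -[i j] _ /=.
    case: ifPn => [ij|/negPn/eqP ->]; last first.
      by rewrite big1// => y _; rewrite eqxx.
    rewrite -(gCRSF_neq_pair _ _ _ _ _ i j)// mulr_sumr [RHS]big_mkcond/=.
    apply: eq_bigr => y _; rewrite !tnth_map (inj_eq val_inj); case: ifP => // _.
    by rewrite /g !ltn_ord/= val_eqE ij; ring.
  by rewrite sumr_offdiag -[LHS]mulr_natr mulrAC divfK.
- by move=> [y [i j]] [y' [i' j']] /= [] /(inj_map val_inj) /val_inj -> /val_inj ->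
    /val_inj ->.
move=> [z [i j]] nh.
apply: (@subset_measure0 _ _ _ P _ (N @^-1` [set n] `&` f @^-1` [set (z, (i, j))])).
- exact: measurableI.
- by apply: measurableI => //; exact: measurable_RV_fiber.
- by move=> w [[Nw _] fw].
apply: (etrans (congr1 _ (esym (atomE z i j)))).
apply: (etrans (atom z i j)); rewrite /g.
(* Either the pair is not admissible and the uniform factor is 0, or the labels are out of range and
   the gCRSF mass is 0. *)
case: ifPn => [/and3P[ilt jlt _]|_]; last by rewrite mulr0.
rewrite gCRSF_out_of_range ?mulr0 ?mul0r// => y yz.
by apply: (nh (y, (Ordinal ilt, Ordinal jlt))); rewrite yz.
Qed.

(** * Summation over the sample size *)

Lemma eq_eseries_ge (R : realType) (m : nat) (f g : nat -> \bar R) :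
  (forall n, (m <= n)%N -> f n = g n) ->
  (\sum_(m <= n <oo) f n = \sum_(m <= n <oo) g n)%E.
Proof. by move=> fg; rewrite !(eseries_cond _ _ m); apply: eq_eseriesr. Qed.

Lemma measure_ge2_fibers (d : measure_display) (T : measurableType d)
    (R : realType) (mu : measure T R) (N : T -> nat) (A : set T) :
  (forall n, measurable (N @^-1` [set n])) -> measurable A ->
  mu (A `&` [set w | (2 <= N w)%N]) =
  (\sum_(2 <= n <oo) mu [set w | N w = n /\ A w])%E.
Proof.
move=> mN mA.
rewrite (_ : A `&` _ =
    \bigcup_(n in [set n | (2 <= n)%N]) [set w | N w = n /\ A w]); last first.
  apply/seteqP; split => [w [Aw Nw]|w [n /= n2 [Nw Aw]]]; first by exists (N w).
  by split; rewrite //= Nw.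
rewrite measure_bigcup.
- rewrite [RHS]eseries_cond; apply: eq_eseriesl => n.
  by rewrite mem_setE /=.
- by move=> n _; exact: (measurableI _ _ (mN n) mA).
- by move=> m n _ _ [w [[<- _] [<- _]]].
Qed.

Lemma prob_ge2 (d : measure_display) (T : measurableType d) (R : realType)
    (P : probability T R) (N : T -> nat) (g0 g1 : R) :
  (forall n, measurable (N @^-1` [set n])) ->
  P (N @^-1` [set 0%N]) = g0%:E -> P (N @^-1` [set 1%N]) = g1%:E ->
  P [set w | (2 <= N w)%N] = (1 - g0 - g1)%:E.
Proof.
move=> mN P0 P1.
rewrite (_ : [set w | _] = ~` (N @^-1` [set 0%N] `|` N @^-1` [set 1%N])).
  rewrite probability_setC; last exact: measurableU.
  transitivity (1 - (g0%:E + g1%:E))%E; last first.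
    by rewrite -addrA -opprD.
  rewrite -P0 -P1; congr (1 - _)%E; apply: measureU => //.
  by apply/seteqP; split => // w [/= ->].
apply/seteqP; split => w /=; first by move=> h [] Nw; rewrite Nw in h.
by case: (N w) => [|[|n]] // h; case: h; [left|right].
Qed.

(** The factor gamma0 (gamma0 + 1) completes the rising factorial from gamma0 + 2 down to gamma0;
    the missing terms of index 0 and 1 are 1 and p gamma0. *)
Lemma sum_Rcoef_a0 (R : realType) (gamma0 p : R) (M : nat) :
  gamma0 * (gamma0 + 1) *
    \sum_(2 <= n < M.+2) p ^+ n / n`!%:R * Rcoef gamma0 0 p n 2 2 =
  egf_sum (rising gamma0) M.+2 p - 1 - p * gamma0.
Proof.
rewrite /egf_sum -(big_mkord xpredT (fun k => p ^+ k / k`!%:R * rising gamma0 k)).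
rewrite [in RHS]big_ltn// [in RHS]big_ltn//.
rewrite risingS rising0 !fact0 expr0 expr1 addr0 !divr1 !mul1r.
rewrite mulr_sumr (_ : _ - p * gamma0 =
  \sum_(2 <= k < M.+2) p ^+ k / k`!%:R * rising gamma0 k); last by ring.
apply: eq_big_nat => -[|[|n]]// _.
by rewrite /Rcoef !subSS subn0 Rrec_a0 !risingSl -addrA; ring.
Qed.

Lemma lim_Rcoef_a0 (R : realType) (gamma0 p : R) : 0 < gamma0 -> 0 < p < 1 ->
  gamma0 * (gamma0 + 1) *
    limn (fun N => \sum_(2 <= n < N) p ^+ n / n`!%:R * Rcoef gamma0 0 p n 2 2) =
  expR (- gamma0 * ln (1 - p)) - 1 - p * gamma0.
Proof.
move=> g0 p01.
have cv := @egf_Rcoef_is_cvg R gamma0 0 p ltr01 g0 p01.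
set v := fun N => _ in cv *.
have h1 : gamma0 * (gamma0 + 1) * v N.+2 @[N --> \oo] -->
    gamma0 * (gamma0 + 1) * limn v.
  apply: cvgM; first exact: cvg_cst.
  rewrite (cvg_shiftS (fun N => v N.+1)) (cvg_shiftS v).
  exact: cv.
have h2 : egf_sum (rising gamma0) N.+2 p - 1 - p * gamma0 @[N --> \oo] -->
    expR (- gamma0 * ln (1 - p)) - 1 - p * gamma0.
  apply: cvgB; last exact: cvg_cst.
  apply: cvgB; last exact: cvg_cst.
  rewrite (cvg_shiftS (fun N => egf_sum (rising gamma0) N.+1 p)).
  exact: cvg_negative_binomial_series.
apply: cvg_unique h1 _ => //.
rewrite (_ : (fun N => _) =
  (fun N => egf_sum (rising gamma0) N.+2 p - 1 - p * gamma0))//.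
by apply/funext => N; rewrite -sum_Rcoef_a0.
Qed.

Lemma lim_Rcoef_gt0 (R : realType) (gamma0 a p : R) :
  a < 1 -> 0 < gamma0 -> 0 < p < 1 ->
  0 < limn (fun N => \sum_(2 <= n < N) p ^+ n / n`!%:R * Rcoef gamma0 a p n 2 2).
Proof.
move=> a1 g0 p01; have cv := @egf_Rcoef_is_cvg R gamma0 a p a1 g0 p01.
have [p0 p1] := andP p01.
set v := fun N => _ in cv *.
have v_nd : nondecreasing_seq v by exact: nondecreasing_sum_Rcoef (ltW p0).
(* [v 3] is the single term n = 2, namely p^2 / 2!, since R_2(2, 2) = 1. *)
apply: lt_le_trans (nondecreasing_cvgn_le v_nd cv 3).
by rewrite /v big_nat1 /Rcoef subnn /= mulr1 divr_gt0 ?exprn_gt0 ?ltr0n ?fact_gt0.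
Qed.

Theorem corollary7 (R : realType) (gamma0 a p : R)
  (ha : a < 1) (hp : 0 < p < 1) (hgamma : 0 < gamma0) :
  let E : R := expR (- gamma0 * gNB_rate a p) in
  let S : \bar R :=
    (\sum_(2 <= n <oo)
       (gCRSF_neq12 gamma0 a p n
        * (gNB gamma0 a p n / (1 - gNB gamma0 a p 0 - gNB gamma0 a p 1)))%:E)%E
  in
  [/\ S \is a fin_num,
      forall (d : measure_display) (T : measurableType d)
             (P : probability T R) (N : {RV P >-> nat})
             (Z : nat -> {RV P >-> nat}) (I J : {RV P >-> nat}),
        gCRSF_sampling gamma0 a p N Z I J ->
        (cond_prob P [set w | Z (I w) w <> Z (J w) w]
                     [set w | (2 <= N w)%N])%:E = S
        /\ (cond_prob P [set w | Z 0%N w <> Z 1%N w]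
                        [set w | (2 <= N w)%N])%:E = S,
      S = ((gamma0 ^+ 2 * p `^ (- 2%:R * a) * E
              / (1 - E - gamma0 * p `^ (1 - a) * E))%:E
           * \sum_(2 <= n <oo)
               (p ^+ n / n`!%:R * Rcoef gamma0 a p n 2 2)%:E)%E
    & a = 0 -> S = (gamma0 / (1 + gamma0))%:E].
Proof.
move=> E S; have [p0 p1] := andP hp.
pose C := gamma0 ^+ 2 * p `^ (- 2%:R * a) * E.
pose D := 1 - E - gamma0 * p `^ (1 - a) * E.
pose u n := p ^+ n / n`!%:R * Rcoef gamma0 a p n 2 2.
pose L := limn (fun N => \sum_(2 <= n < N) u n).
have cu : cvgn (fun N => \sum_(2 <= n < N) u n) by exact: egf_Rcoef_is_cvg.
have DE : 1 - gNB gamma0 a p 0 - gNB gamma0 a p 1 = D by rewrite gNB0 gNB1.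
(* All four claims are read off from this real value, in which [D] is the probability that N >=
   2. *)
have SE : S = (C / D * L)%:E.
  rewrite -nneseries_EFin//; apply: eq_eseries_ge => n n2.
  by rewrite DE mulrA gCRSF_neq12_gNB// mulrAC.
have jointE : (\sum_(2 <= n <oo)
    (gNB gamma0 a p n * gCRSF_neq12 gamma0 a p n)%:E)%E = (C * L)%:E.
  rewrite -nneseries_EFin//; apply: eq_eseries_ge => n n2.
  by rewrite mulrC gCRSF_neq12_gNB.
split.
- by rewrite SE.
- move=> d T P N Z I J hs; have [hN _ _] := hs.
  have mN n := @measurable_RV_fiber _ _ _ P N n.
  have mZ i l := @measurable_RV_fiber _ _ _ P (Z i) l.
  have mI l := @measurable_RV_fiber _ _ _ P I l.
  have mJ l := @measurable_RV_fiber _ _ _ P J l.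
  have PE : P [set w | (2 <= N w)%N] = D%:E.
    by rewrite -DE; exact: (prob_ge2 _ _ _ P N _ _ mN (hN 0%N) (hN 1%N)).
  (* Only the joint probabilities with N = n matter, and they agree for the random pair and for the
     first two positions. *)
  have condE (A : set T) : measurable A ->
      (forall n, (2 <= n)%N -> P [set w | N w = n /\ A w] =
         (gNB gamma0 a p n * gCRSF_neq12 gamma0 a p n)%:E) ->
      (cond_prob P A [set w | (2 <= N w)%N])%:E = S.
    move=> mA hA; rewrite /cond_prob PE measure_ge2_fibers//.
    rewrite (eq_eseries_ge _ _ _ _ hA).
    by rewrite jointE SE /= mulrAC.
  split; apply: condE.
  + apply: measurable_neq_fibers => k.
      exact: (measurable_random_index _ T (fun i => Z i) _ _ mZ mI).
    exact: (measurable_random_index _ T (fun i => Z i) _ _ mZ mJ).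
  + by move=> n n2; exact: sampling_neqIJ hs n2.
  + exact: measurable_neq_fibers.
  + by move=> n n2; exact: sampling_neq12 hs n2.
- have := @nneseries_EFin R 1 u cu; under eq_eseriesr do rewrite mul1r.
  by rewrite mul1r => ->; rewrite SE -EFinM.
- move=> a0; rewrite SE; congr (_%:E).
  have L0 : L != 0 by rewrite gt_eqF// lim_Rcoef_gt0.
  have E0 : E != 0 by rewrite gt_eqF// expR_gt0.
  have h : gamma0 * (gamma0 + 1) * L = E^-1 - 1 - p * gamma0.
    rewrite /L /u /E /gNB_rate a0 eqxx mulrNN -expRN -mulNr.
    exact: lim_Rcoef_a0.
  (* At a = 0, E^-1 = (1 - p)^(-gamma0), so [D] is [E] times the series without its first two terms;
     [E] and [L] then cancel in C / D * L. *)
  have -> : D = E * (gamma0 * (gamma0 + 1) * L).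
    by rewrite h /D a0 subr0 powRr1 ?ltW//; field.
  rewrite /C a0 mulr0 powRr0; field.
  by rewrite E0 L0 !gt_eqF// addr_gt0.
Qed.
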